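(* Let $X$ be a set, let $\mathcal{A}$ and $\mathcal{B}$ be unital $C^*$-algebras, and let $k: X\times X\to\mathcal{L}(\mathcal{A},\mathcal{B})$ be a kernel. The following are equivalent: (i) $k$ is the difference of two completely positive kernels, i.e. $k\in\mathbb{D}^h_X(\mathcal{A},\mathcal{B})$; (ii) there is a completely positive kernel $L\in\mathbb{K}_X^+(\mathcal{A},\mathcal{B})$ such that $-L\le k\le L$; (iii) there is a completely positive kernel $L\in\mathbb{K}_X^+(\mathcal{A},\mathcal{B})$ such that $k\le L$; (iv) $k$ has a hermitian Kolmogorov decomposition; (v) $k$ has a hermitian Kolmogorov decomposition $(E,\iota,J)$ such that $J^2=I_E$.
   Context: $\mathcal{L}(\mathcal{A},\mathcal{B})$ is the space of bounded linear maps from $\mathcal{A}$ to $\mathcal{B}$; a kernel on $X$ is a function $k: X\times X\to\mathcal{L}(\mathcal{A},\mathcal{B})$, and $k(x,y)[a]$ denotes the value of the map $k(x,y)$ at $a\in\mathcal{A}$. Kernels are added and subtracted pointwise. $\mathbb{K}_X^+(\mathcal{A},\mathcal{B})$ is the set of completely positive kernels, i.e. kernels $k$ with $\sum_{i,j=1}^n b_i^*\,k(x_i,x_j)[a_i^*a_j]\,b_j\ge 0$ for all $n\in\mathbb{N}$, $x_1,\dots,x_n\in X$, $a_1,\dots,a_n\in\mathcal{A}$, $b_1,\dots,b_n\in\mathcal{B}$. For kernels $k_1,k_2$, write $k_1\le k_2$ if $k_2-k_1\in\mathbb{K}_X^+(\mathcal{A},\mathcal{B})$. $\mathbb{D}^h_X(\mathcal{A},\mathcal{B})$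 is the set of kernels of the form $k_1-k_2$ with $k_1,k_2\in\mathbb{K}_X^+(\mathcal{A},\mathcal{B})$ (such kernels are automatically hermitian, i.e. satisfy $k(x,y)[a]=(k(y,x)[a^*])^*$). An $(\mathcal{A},\mathcal{B})$-correspondence $E$ is a (right) Hilbert $C^*$-module over $\mathcal{B}$, with $\mathcal{B}$-valued inner product $\langle\cdot,\cdot\rangle$ linear in the second argument, together with a left action of $\mathcal{A}$ given by a unital $*$-homomorphism $\mathcal{A}\to\mathcal{L}^a(E)$, where $\mathcal{L}^a(E)$ is the $C^*$-algebra of adjointable operators on $E$. A Kolmogorov decomposition of $k$ is a triple $(E,\iota,J)$ with $E$ an $(\mathcal{A},\mathcal{B})$-correspondence, $\iota:X\to E$ a map, and $J\in\mathcal{L}^a(E)$ a contractive $\mathcal{A}$-module map (i.e. $J(a\cdot e)=a\cdot J(e)$), such that $k(x,y)[a]=\langle J\iota(x), a\cdot\iota(y)\rangle$ for all $x,y\in X$ and $a\in\mathcal{A}$. It is hermitian if $J$ is self-adjoint. *)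

(* Defs.v *)
From HB Require Import structures.
From mathcomp Require Import all_boot all_order all_algebra.
From mathcomp Require Import complex.
From mathcomp Require Import boolp classical_sets functions reals.
From mathcomp Require Import topology normedtype.

Set Implicit Arguments.
Unset Strict Implicit.
Unset Printing Implicit Defensive.

Import Order.TTheory GRing.Theory Num.Theory.
Import numFieldNormedType.Exports.

Local Open Scope ring_scope.

(* Unital complex C*-algebras, the zero algebra included. Hierarchy Builder
   admits no join of [GRing.PzRing] and [NormedModule] below [Num.NumDomain],
   so the product is a field of the mixin, and the ring structure is
   declared as an instance afterwards. Norms are valued in R[i], where
   [0 <= z] means that z is a nonnegative real. *)
HB.mixin Record isCStarAlgebra (R : realType) A
    of CompleteNormedModule R[i] A := {
  cstar_one : A;
  cstar_mul : A -> A -> A;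
  star : A -> A;
  cstar_mulA : associative cstar_mul;
  cstar_mul1l : left_id cstar_one cstar_mul;
  cstar_mul1r : right_id cstar_one cstar_mul;
  cstar_mulDl : left_distributive cstar_mul +%R;
  cstar_mulDr : right_distributive cstar_mul +%R;
  cstar_mulZl : forall (l : R[i]) (a b : A),
    cstar_mul (l *: a) b = l *: cstar_mul a b;
  cstar_mulZr : forall (l : R[i]) (a b : A),
    cstar_mul a (l *: b) = l *: cstar_mul a b;
  starD : forall a b : A, star (a + b) = star a + star b;
  starZ : forall (l : R[i]) (a : A), star (l *: a) = l^* *: star a;
  starM : forall a b : A, star (cstar_mul a b) = cstar_mul (star b) (star a);
  starK : involutive star;
  cstar_normM : forall a b : A, `|cstar_mul a b| <= `|a| * `|b|;
  cstar_norm : forall a : A, `|cstar_mul (star a) a| = `|a| ^+ 2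
}.

#[short(type="cstarAlgType")]
HB.structure Definition CStarAlgebra (R : realType) :=
  {A of isCStarAlgebra R A & CompleteNormedModule R[i] A}.

Section CStarAlgebraRing.
Context (R : realType) (A : cstarAlgType R).

HB.instance Definition _ := GRing.Zmodule_isPzRing.Build (CStarAlgebra.sort A)
  (@cstar_mulA _ A) (@cstar_mul1l _ A) (@cstar_mul1r _ A)
  (@cstar_mulDl _ A) (@cstar_mulDr _ A).

End CStarAlgebraRing.

Definition cstar_pos (R : realType) (A : cstarAlgType R) (a : A) : Prop :=
  exists c : A, a = star c * c.

(* The space L(A, B) of bounded linear maps, with its pointwise addition. *)
Section BoundedLinear.
Context (R : realType) (A B : cstarAlgType R).

Definition bounded_linear (f : A -> B) : Prop :=
  linear f /\ exists M : R[i], forall a, `|f a| <= M * `|a|.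

Definition bounded_linear_pred : {pred A -> B} :=
  fun f => `[< bounded_linear f >].

Fact bounded_linear_zmod_closed : zmod_closed bounded_linear_pred.
Proof.
split=> [|f g /asboolP[fL [M fM]] /asboolP[gL [N gN]]]; apply/asboolP.
  split=> [l a b|]; first by rewrite /= scaler0 addr0.
  by exists 0 => a; rewrite mul0r normr0.
split=> [l a b|]; first by rewrite !fctE fL gL scalerBr opprD addrACA.
exists (M + N) => a; rewrite mulrDl.
by rewrite (le_trans (ler_normB _ _))// lerD.
Qed.

HB.instance Definition _ := GRing.isZmodClosed.Build (A -> B)
  bounded_linear_pred bounded_linear_zmod_closed.

Record blinear := Blinear {
  blinear_fun :> A -> B;
  _ : blinear_fun \in bounded_linear_pred
}.

HB.instance Definition _ := [isSub for blinear_fun].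
HB.instance Definition _ := [Choice of blinear by <:].
HB.instance Definition _ := [SubChoice_isSubZmodule of blinear by <:].

End BoundedLinear.

(* Kernels inherit pointwise addition and opposite from [blinear A B]. *)
Definition kernel (R : realType) (X : Type) (A B : cstarAlgType R) :=
  X -> X -> blinear A B.

HB.instance Definition _ (R : realType) (X : Type) (A B : cstarAlgType R) :=
  GRing.Zmodule.on (kernel X A B).

Section Kernels.
Context (R : realType) (X : Type) (A B : cstarAlgType R).
Implicit Types k : kernel X A B.

Definition completely_positive k : Prop :=
  forall (n : nat) (x : 'I_n -> X) (a : 'I_n -> A) (b : 'I_n -> B),
    cstar_pos (\sum_(i < n) \sum_(j < n)
      star (b i) * k (x i) (x j) (star (a i) * a j) * b j).

Definition kernel_le k1 k2 : Prop := completely_positive (k2 - k1).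

Definition cp_difference k : Prop :=
  exists k1 k2 : kernel X A B,
    [/\ completely_positive k1, completely_positive k2
      & k = k1 - k2].

End Kernels.

(* Right Hilbert C*-modules over B; [inner_norm] makes completeness that of
   the norm of the inner product. *)
HB.mixin Record isHilbertModule (R : realType) (B : cstarAlgType R) E
    of CompleteNormedModule R[i] E := {
  ract : E -> B -> E;
  ract1 : forall e, ract e 1 = e;
  ractM : forall e b c, ract e (b * c) = ract (ract e b) c;
  ractDl : forall e f b, ract (e + f) b = ract e b + ract f b;
  ractDr : forall e b c, ract e (b + c) = ract e b + ract e c;
  ractZl : forall (l : R[i]) e b, ract (l *: e) b = l *: ract e b;
  ractZr : forall (l : R[i]) e b, ract e (l *: b) = l *: ract e b;
  inner : E -> E -> B;
  innerDr : forall e f g, inner e (f + g) = inner e f + inner e g;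
  innerZr : forall (l : R[i]) e f, inner e (l *: f) = l *: inner e f;
  inner_ract : forall e f b, inner e (ract f b) = inner e f * b;
  inner_star : forall e f, star (inner e f) = inner f e;
  inner_pos : forall e, cstar_pos (inner e e);
  inner_def : forall e, inner e e = 0 -> e = 0;
  inner_norm : forall e, `|e| ^+ 2 = `|inner e e|
}.

#[short(type="hilbertModType")]
HB.structure Definition HilbertModule (R : realType) (B : cstarAlgType R) :=
  {E of isHilbertModule R B E & CompleteNormedModule R[i] E}.

Section Adjointable.
Context (R : realType) (B : cstarAlgType R) (E : hilbertModType B).

(* Possession of an adjoint forces T to be B-linear and bounded. *)
Definition is_adjoint (T S : E -> E) : Prop :=
  forall e f : E, inner (T e) f = inner e (S f) :> B.

Definition adjointable (T : E -> E) : Prop := exists S, is_adjoint T S.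

Definition self_adjoint (T : E -> E) : Prop := is_adjoint T T.

Definition contractive (T : E -> E) : Prop := forall e : E, `|T e| <= `|e|.

End Adjointable.

(* (A, B)-correspondences: [a |-> lact a] is a unital *-homomorphism into the
   adjointable operators, [lact_star] stating both that [lact a] is adjointable
   and that its adjoint is [lact (star a)]. *)
HB.mixin Record isCorrespondence (R : realType) (A B : cstarAlgType R) E
    of HilbertModule R B E := {
  lact : A -> E -> E;
  lactD : forall a b e, lact (a + b) e = lact a e + lact b e;
  lactZ : forall (l : R[i]) a e, lact (l *: a) e = l *: lact a e;
  lactM : forall a b e, lact (a * b) e = lact a (lact b e);
  lact1 : forall e, lact 1 e = e;
  lact_star : forall a, is_adjoint (lact a) (lact (star a))
}.

#[short(type="correspondenceType")]
HB.structure Definition Correspondence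
    (R : realType) (A B : cstarAlgType R) :=
  {E of isCorrespondence R A B E & HilbertModule R B E}.

Section Kolmogorov.
Context (R : realType) (X : Type) (A B : cstarAlgType R).
Implicit Types (k : kernel X A B) (E : correspondenceType A B).

Definition Kolmogorov_decomposition k E (iota : X -> E) (J : E -> E) : Prop :=
  [/\ adjointable J, contractive J,
      forall (a : A) (e : E), J (lact a e) = lact a (J e)
    & forall x y (a : A), k x y a = inner (J (iota x)) (lact a (iota y))].

Definition hermitian_decomposition k E (iota : X -> E) (J : E -> E) : Prop :=
  Kolmogorov_decomposition k iota J /\ self_adjoint J.

End Kolmogorov.

(* Main.v *)
(* A kernel is a difference of completely positive ones as soon as it has a
   hermitian decomposition (E, iota, J): with L x y a = <iota x, a iota y>, both
   L and L - k are completely positive, the latter because 1 - J = S^2 for a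
   self-adjoint S, a limit of polynomials in J. Conversely, if k = k1 - k2, let
   J act as 1 on the Kolmogorov space of k1 and as -1 on that of k2.
   The same square root of 1 - T, applied to left multiplications, yields the
   order theory of C*-algebras (sums of elements c^* c are of this form) without
   any spectral theory. *)
Require Import Defs.
From HB Require Import structures.
From mathcomp Require Import all_boot all_order all_algebra.
From mathcomp Require Import complex ring lra.
From mathcomp Require Import boolp classical_sets functions reals.
From mathcomp Require Import topology normedtype sequences.

Set Implicit Arguments.
Unset Strict Implicit.
Unset Printing Implicit Defensive.

Import Order.TTheory GRing.Theory Num.Theory.
Import numFieldNormedType.Exports.

Local Open Scope classical_set_scope.
Local Open Scope ring_scope.

(** Elements c^* c do not visibly form a set closed under addition. The way round is the criterion
    |t - a| <= t for self-adjoint a: it is additive by the triangle inequality, and rescaling turns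
    a into 1 - x with |x| <= 1, which has a square root. This root commutes with whatever commutes
    with a, which stands in for functional calculus: it makes pairs of roots commute where two
    squares have to be compared. The hard point is that every c^* c meets the criterion. The
    Kolmogorov space of a kernel is classically a quotient by null vectors followed by a completion.
    Both are achieved at once by replacing a vector v by the functional <., v>, which sees only
    inner products. *)

Local Notation "t %:C" := (real_complex _ t) : ring_scope.

(** * Real-valued norms and sequences *)

Section RealNorm.
Context (R : realType) (V : normedModType R[i]).
Implicit Types (v w : V) (t : R).

(* The library norm takes values in R[i]; its real part allows estimates to be
   carried out in the ordered field R. *)
Definition nrm v : R := complex.Re `|v|.

Lemma nrmE v : `|v| = (nrm v)%:C.
Proof. by rewrite /nrm RRe_real// ger0_real. Qed.

Lemma nrm_ge0 v : 0 <= nrm v.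
Proof. by rewrite -ler0c -nrmE. Qed.

Lemma nrm0 : nrm 0 = 0.
Proof. by rewrite /nrm normr0. Qed.

Lemma nrm0_eq0 v : nrm v = 0 -> v = 0.
Proof. by move=> v0; apply/eqP; rewrite -normr_eq0 nrmE v0. Qed.

Lemma nrmD v w : nrm (v + w) <= nrm v + nrm w.
Proof. by rewrite -lecR rmorphD/= -!nrmE ler_normD. Qed.

Lemma nrmN v : nrm (- v) = nrm v.
Proof. by rewrite /nrm normrN. Qed.

Lemma nrmB v w : nrm (v - w) <= nrm v + nrm w.
Proof. by rewrite -(nrmN w) nrmD. Qed.

Lemma nrmC v w : nrm (v - w) = nrm (w - v).
Proof. by rewrite -nrmN opprB. Qed.

Lemma nrm_tri u v w : nrm (u - w) <= nrm (u - v) + nrm (v - w).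
Proof. by rewrite -[u - w](subrKA v) nrmD. Qed.

Lemma nrmZ t v : nrm (t%:C *: v) = `|t| * nrm v.
Proof.
apply: complexI; rewrite rmorphM/= -!nrmE normrZ; congr (_ * _).
by rewrite normc_def/= expr0n addr0 sqrtr_sqr.
Qed.

Lemma nrmZc (l : R[i]) v : nrm (l *: v) = complex.Re `|l| * nrm v.
Proof.
by apply: complexI; rewrite rmorphM/= -!nrmE normrZ.
Qed.

Lemma Re_normC (l : R[i]) : (complex.Re `|l|)%:C = `|l|.
Proof. by rewrite RRe_real// ger0_real. Qed.

Lemma Re_norm_ge0 (l : R[i]) : 0 <= complex.Re `|l|.
Proof. by rewrite -ler0c Re_normC. Qed.

Lemma ball_nrm v w t : ball v t%:C w <-> nrm (v - w) < t.
Proof. by rewrite -ball_normE /ball_/= nrmE ltcR. Qed.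

Lemma scale2C v : (2 : R)%:C *: v = v + v.
Proof. by rewrite rmorphD/= scalerDl scale1r. Qed.

Lemma cvg_nrmP (u : nat -> V) l :
  (u @ \oo --> l) <-> ((fun n => nrm (u n - l)) @ \oo --> (0 : R)).
Proof.
split=> [/cvgrPdist_lt ul|/cvgrPdist_lt ul]; apply/cvgrPdist_lt => e e0.
  have := ul e%:C; rewrite ltcR => /(_ e0).
  apply: filterS => n; rewrite nrmE ltcR sub0r normrN.
  by rewrite ger0_norm ?nrm_ge0// nrmC.
have er : e \is Num.real by rewrite gtr0_real.
move: e0; rewrite -(RRe_real er) ltcR => e0.
apply: filterS (ul _ e0) => n; rewrite sub0r normrN.
by rewrite ger0_norm ?nrm_ge0// nrmC nrmE ltcR.
Qed.

Lemma cvg_squeeze (u : nat -> V) l (b : nat -> R) :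
  (forall n, nrm (u n - l) <= b n) -> b @ \oo --> (0 : R) -> u @ \oo --> l.
Proof.
move=> ub b0; apply/cvg_nrmP; apply: squeeze_cvgr b0; last exact: cvg_cst.
by near=> n; rewrite nrm_ge0 ub.
Unshelve. all: by end_near. Qed.

Lemma cvg_nrm_le (u : nat -> V) l (b : nat -> R) c :
  u @ \oo --> l -> b @ \oo --> c -> (forall n, nrm (u n) <= b n) ->
  nrm l <= c.
Proof.
move=> /cvg_nrmP ul bc ub.
rewrite -[c]add0r; apply: (ler_cvg_to (cvg_cst (nrm l)) (cvgD ul bc)).
near=> n; rewrite (le_trans _ (lerD (lexx _) (ub n)))//.
by rewrite nrmC -{1}(subrK (u n) l) nrmD.
Unshelve. all: by end_near. Qed.

Lemma cvg_nrm (u : nat -> V) (l : V) :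
  u @ \oo --> l -> (fun n => nrm (u n)) @ \oo --> nrm l.
Proof.
move=> /cvg_nrmP ul; apply/subr_cvg0.
apply/norm_cvg0P; apply: squeeze_cvgr ul; last exact: cvg_cst.
near=> n; rewrite normr_ge0 ler_distl /=; apply/andP; split.
  by rewrite lerBlDr nrmC (le_trans _ (nrmD _ _))// addrC subrK.
by rewrite (le_trans _ (nrmD _ _))// addrC subrK.
Unshelve. all: by end_near. Qed.

Lemma cvg_seq_unique (u : nat -> V) (l m : V) :
  u @ \oo --> l -> u @ \oo --> m -> l = m.
Proof. by move=> /cvg_lim <- // /cvg_lim <-. Qed.

End RealNorm.

Section Completeness.
Context (R : realType) (V : completeNormedModType R[i]).

Lemma harmonic_lt (e : R) : 0 < e -> exists n, n.+1%:R^-1 < e.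
Proof.
move=> e0; have /cvgrPdist_lt/(_ _ e0)[n _ /(_ n (leqnn n))] := @cvg_harmonic R.
by rewrite /= sub0r normrN ger0_norm ?invr_ge0//; exists n.
Qed.

Lemma cvg_harmonicMl (c : R) : (fun n => c * n.+1%:R^-1) @ \oo --> (0 : R).
Proof.
rewrite -(mulr0 c); apply: cvgM; first exact: cvg_cst.
exact: cvg_harmonic.
Qed.

(** The rate c / (n + 1) suits both uses: it bounds the tails of Visser's iteration, and 1 / (n + 1)
    is the tolerance of the approximants chosen in the completion. *)
Lemma cauchy_rate_cvg (u : nat -> V) (c : R) :
  (forall n m, (n <= m)%N -> nrm (u m - u n) <= c * n.+1%:R^-1) ->
  exists l : V, u @ \oo --> l.
Proof.
move=> uc; suff : cvg (u @ \oo) by move=> ul; exists (lim (u @ \oo)).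
apply: (@cauchy_cvg V _ _); apply/cauchy_exP => e e0.
have er : e \is Num.real by rewrite gtr0_real.
move: e0; rewrite -(RRe_real er) ltcR; move: (complex.Re e) => {er}e e0.
have /cvgrPdist_lt/(_ _ e0)[N _ Ne] := cvg_harmonicMl c.
exists (u N); exists N => // n /= Nn.
rewrite -ball_normE /ball_/= nrmE ltcR nrmC.
apply: le_lt_trans (uc N n Nn) _.
have := Ne N (leqnn N); rewrite /= sub0r normrN.
exact: le_lt_trans (ler_norm _).
Qed.

End Completeness.

(** * Square roots of 1 - T *)

Section LinearProp.
Context (K : pzRingType) (V W : lmodType K) (f : V -> W).
Hypothesis f_lin : linear f.

Lemma linD u v : f (u + v) = f u + f v.
Proof. by rewrite -{1}(scale1r u) f_lin scale1r. Qed.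

Lemma lin0 : f 0 = 0.
Proof. by apply: (addIr (f 0)); rewrite -linD !add0r. Qed.

Lemma linZ a v : f (a *: v) = a *: f v.
Proof. by rewrite -(addr0 (a *: v)) f_lin lin0 addr0. Qed.

Lemma linB u v : f (u - v) = f u - f v.
Proof. by rewrite linD -scaleN1r linZ scaleN1r. Qed.

End LinearProp.

(* Visser's iteration for 1 - sqrt(1 - T): its limit Y solves Y = (T + Y^2)/2,
   that is, (1 - Y)^2 = 1 - T. Its bounds are governed by the scalar iteration
   with T = 1. *)
Section Visser.
Context (R : realType).

Fixpoint visser_bound (n : nat) : R :=
  if n is n'.+1 then 2^-1 * (1 + visser_bound n' ^+ 2) else 0.

Local Notation y := visser_bound.

Lemma visser_bound_ge0 n : 0 <= y n.
Proof.
case: n => [|n] //=; rewrite mulr_ge0 ?invr_ge0// addr_ge0// sqr_ge0 //.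
Qed.

Lemma visser_bound_le1 n : y n <= 1.
Proof. by elim: n => [|n IHn] //=; have := visser_bound_ge0 n; nra. Qed.

(** The error e = 1 - y obeys e' = e - e^2 / 2, and the induction carries e (m + 1) <= 2 with m = n
    + 1: the value 2 / (m + 1) is sent to 2 m / (m + 1)^2 <= 2 / (m + 2). Keeping m as a real hides
    the cast from the arithmetic tactics. *)
Lemma visser_bound_lim n : 1 - y n <= 2 * n.+1%:R^-1.
Proof.
suff [m [m0 my]] : exists m : R, m = n.+1%:R /\ (1 - y n) * (m + 1) <= 2.
  rewrite -m0 ler_pdivlMr ?m0// -m0.
  by apply: le_trans my; rewrite ler_wpM2l ?subr_ge0 ?visser_bound_le1 ?lerDl.
elim: n => [|n [m [m1 IHn]]] /=.
  by exists 1; split => //; rewrite subr0; lra.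
exists (m + 1); split; first by rewrite m1 natr1.
have y0 := visser_bound_ge0 n; have y1 := visser_bound_le1 n.
have m0 : 0 < m by rewrite m1.
move: (y n) y0 y1 IHn => z z0 z1 IHn.
have [e ez] : exists e, e = 1 - z by exists (1 - z).
rewrite -ez in IHn.
have -> : 1 - 2^-1 * (1 + z ^+ 2) = e - e ^+ 2 / 2 by rewrite ez; field.
have e0 : 0 <= e by lra.
have e1 : e <= 1 by lra.
have m2 : 0 < m + 1 by lra.
rewrite -(ler_pM2r m2).
have -> : (e - e ^+ 2 / 2) * (m + 1 + 1) * (m + 1) =
  (e * (m + 1)) * (m + 2) - (e * (m + 1)) ^+ 2 / 2 * ((m + 2) / (m + 1)).
  by field; lra.
move: (e * (m + 1)) IHn => q IHn.
have -> : (m + 2) / (m + 1) = 1 + (m + 1)^-1 by field; lra.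
have r0 : 0 < (m + 1)^-1 by rewrite invr_gt0.
have [q1|q1] := leP q 1; first by nra.
have : 0 <= (2 - q) * m by nra.
nra.
Qed.

Lemma visser_bound_cvg c : (fun n => (1 - y n) * c) @ \oo --> (0 : R).
Proof.
rewrite -(mul0r c); apply: cvgM; last exact: cvg_cst.
apply: squeeze_cvgr (cvg_harmonicMl 2); last exact: cvg_cst.
by near=> n; rewrite subr_ge0 visser_bound_le1 visser_bound_lim.
Unshelve. all: by end_near. Qed.

Section Operator.
Context (V : completeNormedModType R[i]) (T : V -> V).

Fixpoint visser (n : nat) (v : V) : V :=
  if n is n'.+1 then (2^-1 : R)%:C *: (T v + visser n' (visser n' v)) else 0.

Definition sqrt1B (v : V) : V := v - lim ((visser ^~ v) @ \oo).

Hypotheses (T_lin : linear T) (T_contr : forall v, nrm (T v) <= nrm v).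

Lemma visser_linear n : linear (visser n).
Proof.
elim: n => [|n IHn] a u v /=; first by rewrite scaler0 addr0.
rewrite T_lin !IHn scalerA mulrC -scalerA -scalerDr; congr (_ *: _).
by rewrite scalerDr addrACA.
Qed.

Lemma visser_le n v : nrm (visser n v) <= y n * nrm v.
Proof.
elim: n v => [|n IHn] v /=; first by rewrite nrm0 mul0r.
rewrite nrmZ ger0_norm ?invr_ge0// -mulrA ler_wpM2l ?invr_ge0//.
rewrite (le_trans (nrmD _ _))// mulrDl mul1r lerD// expr2 -mulrA.
by rewrite (le_trans (IHn _))// ler_wpM2l ?visser_bound_ge0.
Qed.

(** The identity P^2 - Q^2 = (P - Q) P + Q (P - Q) holds without commutation, and for successive
    iterates the bound it yields is the scalar one, (p - q) (p + q) = p^2 - q^2. *)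
Lemma visser_step n v :
  nrm (visser n.+1 v - visser n v) <= (y n.+1 - y n) * nrm v.
Proof.
elim: n v => [|n IHn] v.
  rewrite /= !subr0 addr0 nrmZ ger0_norm ?invr_ge0// expr0n/= addr0 mulr1.
  by rewrite ler_wpM2l ?invr_ge0.
rewrite [visser n.+2 v]/= [X in _ - X]/= -scalerBr opprD addrACA subrr add0r.
rewrite -[visser n.+1 _ - _](subrKA (visser n (visser n.+1 v))).
rewrite -(linB (visser_linear n)) nrmZ ger0_norm ?invr_ge0//.
have := nrmD (visser n.+1 (visser n.+1 v) - visser n (visser n.+1 v))
  (visser n (visser n.+1 v - visser n v)).
have := IHn (visser n.+1 v); have := visser_le n (visser n.+1 v - visser n v).
have := ler_wpM2l (visser_bound_ge0 n) (IHn v).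
have yy : 0 <= y n.+1 - y n.
  by rewrite /=; have := sqr_ge0 (1 - y n); rewrite sqrrB expr1n mul1r; lra.
have := ler_wpM2l yy (visser_le n.+1 v).
have -> : y n.+2 - y n.+1 = 2^-1 * (y n.+1 ^+ 2 - y n ^+ 2).
  by rewrite /=; ring.
by nra.
Qed.

Lemma visser_cauchy n m v : (n <= m)%N ->
  nrm (visser m v - visser n v) <= (1 - y n) * nrm v.
Proof.
move=> nm; apply: le_trans (_ : (y m - y n) * nrm v <= _); last first.
  by rewrite ler_wpM2r ?nrm_ge0// lerD2r visser_bound_le1.
elim: m nm => [|m IHm].
  by rewrite leqn0 => /eqP ->; rewrite !subrr nrm0 mul0r.
rewrite leq_eqVlt => /orP[/eqP ->|]; first by rewrite !subrr nrm0 mul0r.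
move=> /IHm {}IHm; rewrite (le_trans (nrm_tri _ (visser m v) _))//.
by have := visser_step m v; nra.
Qed.

Lemma visser_cvg v : visser ^~ v @ \oo --> v - sqrt1B v.
Proof.
have [n m nm|l vl] := @cauchy_rate_cvg _ _ (visser ^~ v) (2 * nrm v).
  rewrite (le_trans (visser_cauchy v nm))// mulrAC.
  by rewrite ler_wpM2r ?nrm_ge0 ?visser_bound_lim.
by rewrite /sqrt1B opprB addrC subrK (cvg_lim _ vl).
Qed.

Lemma sqrt1B_rate n v : nrm (v - sqrt1B v - visser n v) <= (1 - y n) * nrm v.
Proof.
apply: (cvg_nrm_le (u := fun m => visser (m + n) v - visser n v)).
- apply: cvgB; last exact: cvg_cst.
  by rewrite (@cvg_shiftn n V (visser ^~ v)); exact: visser_cvg.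
- exact: cvg_cst.
- by move=> m; apply: visser_cauchy; exact: leq_addl.
Qed.

Lemma sqrt1B_contr v : nrm (v - sqrt1B v) <= nrm v.
Proof. by have := sqrt1B_rate 0 v; rewrite /= !subr0 mul1r. Qed.

Lemma sqrt1B_linear : linear sqrt1B.
Proof.
move=> a u v; suff : a *: u + v - sqrt1B (a *: u + v) =
    a *: (u - sqrt1B u) + (v - sqrt1B v).
  move/(congr1 (fun x => a *: u + v - x)).
  by rewrite subKr scalerBr addrACA -opprD subKr.
apply: (cvg_seq_unique (@visser_cvg (a *: u + v))).
rewrite (_ : visser ^~ _ = fun n => a *: visser n u + visser n v).
  apply: cvgD; last exact: visser_cvg.
  by apply: cvgZr; exact: visser_cvg.
by apply/funext => n; rewrite visser_linear.
Qed.

Lemma sqrt1BK v : sqrt1B (sqrt1B v) = v - T v.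
Proof.
have [Y YS] : exists Y : V -> V, forall u, Y u = u - sqrt1B u.
  by exists (fun u => u - sqrt1B u).
have SE u : sqrt1B u = u - Y u by rewrite YS subKr.
suff YE : Y v = (2^-1 : R)%:C *: (T v + Y (Y v)).
  have Y2 : Y v + Y v = T v + Y (Y v).
    rewrite {1 2}YE -scalerDl -rmorphD/=.
    have -> : 2^-1 + 2^-1 = 1 :> R by field.
    by rewrite scale1r.
  have YB a b : Y (a - b) = Y a - Y b.
    rewrite !YS (linB sqrt1B_linear) !opprB [LHS]addrACA [RHS]addrACA.
    by congr (_ + _); exact: addrC.
  rewrite [LHS]SE [sqrt1B v]SE YB.
  by rewrite opprB addrACA -opprD Y2 opprD addrACA subrr addr0.
apply: (cvg_seq_unique (u := fun n => visser n.+1 v)).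
  rewrite (_ : (fun n => _) = (fun n => visser (n + 1) v)).
    by rewrite (@cvg_shiftn 1 V (visser ^~ v)) YS; exact: visser_cvg.
  by apply/funext => n; rewrite addn1.
apply: cvgZr; apply: cvgD; first exact: cvg_cst.
(* Operator and argument both vary: Y_n Y_n v - Y Y v = Y_n (Y_n v - Y v) + (Y_n - Y) (Y v), where
   Y_n is contractive and the rate is available at v and at Y v. *)
apply: (cvg_squeeze (b := fun n => (1 - y n) * nrm v + (1 - y n) * nrm (Y v))).
  move=> n; rewrite (le_trans (nrm_tri _ (visser n (Y v)) _))//.
  rewrite -(linB (visser_linear n)) lerD//.
    rewrite (le_trans (visser_le _ _))// -[leRHS]mul1r.
    rewrite ler_pM ?visser_bound_ge0 ?nrm_ge0 ?visser_bound_le1//.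
    by rewrite nrmC YS sqrt1B_rate.
  by rewrite nrmC [Y (Y v)]YS sqrt1B_rate.
by rewrite -[0 in X in _ --> X]addr0; apply: cvgD; exact: visser_bound_cvg.
Qed.

Lemma visser_comm (U : V -> V) n : linear U ->
  (forall v, U (T v) = T (U v)) -> forall v, U (visser n v) = visser n (U v).
Proof.
move=> U_lin UT; elim: n => [|n IHn] w /=; first by rewrite (lin0 U_lin).
by rewrite (linZ U_lin) (linD U_lin) UT !IHn.
Qed.

(** The iterates are polynomials in T, hence commute with U, and boundedness of U carries this to
    the limit. For T a left and U a right multiplication, it shows that the root of a left
    multiplication is again one. *)
Lemma sqrt1B_comm (U : V -> V) (c : R) : 0 <= c -> linear U ->
  (forall v, nrm (U v) <= c * nrm v) -> (forall v, U (T v) = T (U v)) ->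
  forall v, U (sqrt1B v) = sqrt1B (U v).
Proof.
move=> c0 U_lin U_le UT v.
suff : U (v - sqrt1B v) = U v - sqrt1B (U v).
  by rewrite (linB U_lin) => /addrI/oppr_inj.
apply: cvg_seq_unique (@visser_cvg (U v)).
have := visser_bound_cvg (nrm v * c).
apply: cvg_squeeze => n; rewrite -visser_comm// -(linB U_lin).
rewrite (le_trans (U_le _))//.
by rewrite mulrA [leRHS]mulrC ler_wpM2l// nrmC sqrt1B_rate.
Qed.

End Operator.
End Visser.

(** * Positivity in C*-algebras *)

Section CStarTheory.
Context (R : realType) (A : cstarAlgType R).
Implicit Types (a b c d g h p q x y z : A) (s t r : R).

Lemma cscalerAl (l : R[i]) a b : l *: a * b = l *: (a * b).
Proof. exact: cstar_mulZl. Qed.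

Lemma cscalerAr (l : R[i]) a b : a * (l *: b) = l *: (a * b).
Proof. exact: cstar_mulZr. Qed.

Lemma mulCii : 'i * 'i = -1 :> R[i].
Proof. by rewrite -expr2 sqrCi. Qed.

Lemma star0 : star 0 = 0 :> A.
Proof. by rewrite -[X in star X](scale0r 0) starZ conjC0 scale0r. Qed.

Lemma starN a : star (- a) = - star a.
Proof. by apply/eqP; rewrite -addr_eq0 -starD addNr star0. Qed.

Lemma starB a b : star (a - b) = star a - star b.
Proof. by rewrite starD starN. Qed.

Lemma star1 : star 1 = 1 :> A.
Proof.
have : star (star 1 * 1) = star 1 * 1 :> A.
  by rewrite -[LHS]/(star (cstar_mul _ _)) starM starK.
by rewrite mulr1 starK => <-.
Qed.

Lemma starMr a b : star (a * b) = star b * star a.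
Proof. exact: starM. Qed.

Lemma starZr t a : star (t%:C *: a) = t%:C *: star a.
Proof. by rewrite starZ conj_Creal// complex_real. Qed.

Lemma starZi a : star ('i *: a) = - ('i *: star a).
Proof. by rewrite starZ conjCi scaleNr. Qed.

Lemma nrmM a b : nrm (a * b) <= nrm a * nrm b.
Proof. by rewrite -lecR rmorphM/= -!nrmE cstar_normM. Qed.

Lemma nrm_starM a : nrm (star a * a) = nrm a ^+ 2.
Proof. by apply: complexI; rewrite rmorphXn/= -!nrmE cstar_norm. Qed.

Lemma nrm_star a : nrm (star a) = nrm a.
Proof.
suff H b : nrm b <= nrm (star b).
  by apply/eqP; rewrite eq_le H -{2}(starK a) H.
have := nrmM (star b) b; rewrite nrm_starM expr2.
have := nrm_ge0 b; rewrite le_eqVlt => /orP[/eqP <- _|b0].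
  exact: nrm_ge0.
by rewrite ler_pM2r.
Qed.

Lemma nrm_sa_sqr h : star h = h -> nrm (h * h) = nrm h ^+ 2.
Proof. by move=> hs; rewrite -{1}hs nrm_starM. Qed.

Lemma nrm_starM_eq0 a : star a * a = 0 -> a = 0.
Proof.
move=> /(congr1 (@nrm R A)); rewrite nrm_starM nrm0 => /eqP.
by rewrite sqrf_eq0 => /eqP/nrm0_eq0.
Qed.

(** From |1|^2 = |1|. Equality fails in the zero algebra. *)
Lemma nrm1_le1 : nrm (1 : A) <= 1.
Proof.
have := nrm_starM 1; rewrite star1 mulr1 => /eqP.
move: (nrm _) => t; rewrite -subr_eq0 -[X in X - _]mulr1 expr2 -mulrBr.
by rewrite mulf_eq0 => /orP[]/eqP; lra.
Qed.

Lemma nrm_alg t : 0 <= t -> nrm (t%:C *: (1:A)) <= t.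
Proof.
move=> t0; rewrite nrmZ ger0_norm//.
by rewrite -[leRHS]mulr1 ler_wpM2l// nrm1_le1.
Qed.

Lemma cvg_star (u : nat -> A) (l : A) :
  u @ \oo --> l -> star \o u @ \oo --> star l.
Proof.
move=> /cvg_nrmP; apply: cvg_squeeze => n /=.
by rewrite -starB nrm_star.
Qed.

Lemma sa_cvg (u : nat -> A) (l : A) :
  (forall n, star (u n) = u n) -> u @ \oo --> l -> star l = l.
Proof.
move=> us ul; have := cvg_star ul.
rewrite (_ : _ \o _ = u); last by apply/funext => n /=; rewrite us.
by move=> usl; apply: cvg_seq_unique usl ul.
Qed.

(** The operator root of left multiplication by x, evaluated at 1. Its iterates at 1 are real
    polynomials in x, hence self-adjoint. The bound on 1 - c puts c itself in the positive cone,
    with scalar 1. *)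
Lemma sqrt_1B x : star x = x -> nrm x <= 1 ->
  exists c, [/\ star c = c, c * c = 1 - x, nrm (1 - c) <= 1 &
    forall z, z * x = x * z -> z * c = c * z].
Proof.
move=> xs x1; pose T y := x * y.
have T_lin : linear T by move=> l u v; rewrite /T mulrDr cscalerAr.
have Tc v : nrm (T v) <= nrm v.
  by rewrite (le_trans (nrmM _ _))// -[leRHS]mul1r ler_wpM2r ?nrm_ge0.
have Lmul z : linear (fun y => z * y) by move=> l u v; rewrite mulrDr cscalerAr.
have Rmul z : linear (fun y => y * z) by move=> l u v; rewrite mulrDl cscalerAl.
have Tr z v : T v * z = T (v * z) by rewrite /T mulrA.
have SE z : sqrt1B T z = sqrt1B T 1 * z.
  rewrite (sqrt1B_comm T_lin Tc (nrm_ge0 z) (Rmul z) _ (Tr z)) ?mul1r// => v.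
  by rewrite [leRHS]mulrC nrmM.
have VE n z : visser T n z = visser T n 1 * z.
  by rewrite (visser_comm n (Rmul z) (Tr z)) mul1r.
exists (sqrt1B T 1); split.
- suff : star (1 - sqrt1B T 1) = 1 - sqrt1B T 1.
    by rewrite starB star1 => /addrI/oppr_inj.
  apply: sa_cvg (@visser_cvg _ _ T T_lin Tc 1).
  elim=> [|n IHn] /=; first exact: star0.
  by rewrite starZr VE starD /T mulr1 xs starMr IHn.
- by rewrite -SE sqrt1BK// /T mulr1.
- by rewrite (le_trans (sqrt1B_contr _ _ _))// nrm1_le1.
move=> z zx; rewrite -SE -{2}(mulr1 z).
apply: (sqrt1B_comm T_lin Tc (nrm_ge0 z) (Lmul z)) => v; first exact: nrmM.
by rewrite /T !mulrA zx.
Qed.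

Local Notation "t %:I" := (t%:C *: (1 : A)) (format "t %:I").

(* An order-theoretic description of positivity: it is visibly a closed convex
   cone, and [cstar_posP] identifies it with [cstar_pos]. *)
Definition nneg a := star a = a /\ exists t, nrm (t%:I - a) <= t.

Lemma nneg_sa a : nneg a -> star a = a. Proof. by case. Qed.

Lemma nnegD a b : nneg a -> nneg b -> nneg (a + b).
Proof.
move=> [sa [t ta]] [sb [s sb']]; split; first by rewrite starD sa sb.
exists (t + s); rewrite rmorphD/= scalerDl opprD addrACA.
by rewrite (le_trans (nrmD _ _))// lerD.
Qed.

Lemma nnegZ r a : 0 <= r -> nneg a -> nneg (r%:C *: a).
Proof.
move=> r0 [sa [t ta]]; split; first by rewrite starZr sa.
exists (r * t); rewrite rmorphM/= -scalerA -scalerBr nrmZ ger0_norm//.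
by rewrite ler_wpM2l.
Qed.

Lemma nneg_nrmB s y : star y = y -> nrm y <= s -> nneg (s%:I - y).
Proof.
move=> ys yls; split; first by rewrite starB starZr star1 ys.
by exists s; rewrite subKr.
Qed.

(** With x = 1 - a / t, of norm at most 1, the root of a is sqrt t times that of 1 - x. The given
    scalar is first increased by 1 so that t > 0. *)
Lemma nneg_sqrt a : nneg a -> exists h, [/\ star h = h, nneg h, h * h = a &
  forall z, z * a = a * z -> z * h = h * z].
Proof.
move=> [sa [t0 t0a]].
have [t tp ta] : exists2 t, 0 < t & nrm (t%:I - a) <= t.
  have tp := le_trans (nrm_ge0 _) t0a; exists (t0 + 1); first by lra.
  rewrite rmorphD/= scalerDl addrAC (le_trans (nrmD _ _))// lerD//.
  exact: nrm_alg.
pose x := 1 - (t^-1)%:C *: a.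
have tV : t%:C * (t^-1)%:C = 1 by rewrite -rmorphM/= divff// gt_eqF.
have xE : x = (t^-1)%:C *: (t%:I - a).
  by rewrite scalerBr scalerA [X in X *: _]mulrC tV scale1r.
have [||c [cs cc c1 cz]] := @sqrt_1B x.
- by rewrite starB starZr star1 sa.
- by rewrite xE nrmZ gtr0_norm ?invr_gt0// mulrC ler_pdivrMr// mul1r.
exists ((Num.sqrt t)%:C *: c); split.
- by rewrite starZr cs.
- apply: nnegZ; first exact: sqrtr_ge0.
  by split => //; exists 1; rewrite scale1r.
- rewrite cscalerAl cscalerAr scalerA -rmorphM/= -expr2 sqr_sqrtr ?ltW//.
  by rewrite cc subKr scalerA tV scale1r.
move=> z za; rewrite cscalerAr cscalerAl cz//.
by rewrite /x mulrBr mulrBl mulr1 mul1r cscalerAr cscalerAl za.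
Qed.

(* u = p + i q is normal with u^* u = p^2 + q^2, and p is its real part. *)
Lemma comm_sqr_le p q : star p = p -> star q = q -> p * q = q * p ->
  nrm p ^+ 2 <= nrm (p * p + q * q).
Proof.
move=> ps qs pq; pose u := p + 'i *: q.
have us : star u = p - 'i *: q by rewrite starD starZi ps qs.
have <- : star u * u = p * p + q * q.
  rewrite us mulrDr !mulrBl !cscalerAl !cscalerAr scalerA mulCii scaleN1r.
  by rewrite opprK pq addrA subrK.
rewrite nrm_starM ler_sqr ?nnegrE ?nrm_ge0//.
have up : u + star u = (2 : R)%:C *: p.
  by rewrite us addrACA subrr addr0 scale2C.
have := nrmD u (star u); rewrite up nrmZ ger0_norm// nrm_star; lra.
Qed.

(** For g = h / r and c the root of 1 - g^2, the elements c and g commute and c^2 + g^2 = 1, so |c|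
    <= 1 by [comm_sqr_le], while r^2 - h^2 = r^2 c^2. *)
Lemma sqr_bound h r : star h = h -> nrm h <= r ->
  nrm ((r ^+ 2)%:I - h * h) <= r ^+ 2.
Proof.
move=> hs hr; have [r0|r0] := leP r 0.
  have h0 : h = 0 by apply: nrm0_eq0; have := nrm_ge0 h; lra.
  by rewrite h0 mulr0 subr0 nrm_alg// sqr_ge0.
pose g := (r^-1)%:C *: h.
have gs : star g = g by rewrite starZr hs.
have g1 : nrm g <= 1.
  by rewrite nrmZ gtr0_norm ?invr_gt0// mulrC ler_pdivrMr// mul1r.
have [||c [cs cc _ cz]] := @sqrt_1B (g * g).
- by rewrite starMr gs.
- by rewrite nrm_sa_sqr// expr_le1// nrm_ge0.
have c1 : nrm c ^+ 2 <= 1.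
  rewrite (le_trans (@comm_sqr_le c g cs gs _))//.
    by rewrite -cz// mulrA.
  by rewrite cc subrK nrm1_le1.
have -> : (r ^+ 2)%:I - h * h = (r ^+ 2)%:C *: (c * c).
  rewrite cc scalerBr; congr (_ - _).
  have rr : (r ^+ 2)%:C * ((r^-1)%:C * (r^-1)%:C) = 1.
    rewrite -!rmorphM/= -[r^-1 * r^-1]expr2 -exprMn divff ?gt_eqF//.
    by rewrite expr1n.
  by rewrite cscalerAl cscalerAr !scalerA rr scale1r.
rewrite nrmZ ger0_norm ?sqr_ge0// -[leRHS]mulr1 ler_wpM2l ?sqr_ge0//.
by rewrite nrm_sa_sqr.
Qed.

Lemma sqr_nneg h : star h = h -> nneg (h * h).
Proof.
move=> hs; split; first by rewrite starMr hs.
by exists (nrm h ^+ 2); apply: sqr_bound.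
Qed.

(** Write x = h^2 and |y| - x = g^2. These roots commute, so [comm_sqr_le] bounds |h|^2 by the norm
    of h^2 + g^2, the scalar |y|. *)
Lemma nneg_le_nrm x y : nneg x -> nneg (y - x) -> nrm x <= nrm y.
Proof.
move=> /nneg_sqrt[h [hs _ <- hz]] yx.
have : nneg ((nrm y)%:I - h * h).
  rewrite -[_ - _](subrKA y); apply: nnegD => //; apply: nneg_nrmB => //.
  move: (nneg_sa yx); rewrite starB starMr hs.
  by move/(congr1 (fun z => z + h * h)); rewrite !subrK.
move=> /nneg_sqrt[g [gs _ gg gz]].
rewrite nrm_sa_sqr// (le_trans (@comm_sqr_le h g hs gs _))//.
  by apply: gz; rewrite mulrBr mulrBl cscalerAr cscalerAl mulr1 mul1r mulrA.
by rewrite gg addrC subrK nrm_alg ?nrm_ge0.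
Qed.

(** The scalar in [nneg] can be any upper bound of the norm; along a convergent sequence it can
    therefore be chosen convergent, which makes the cone closed. *)
Lemma nneg_nrm_bound a s : nneg a -> nrm a <= s -> nrm (s%:I - a) <= s.
Proof.
move=> /nneg_sqrt[h [hs _ <- _]]; rewrite nrm_sa_sqr// => hl.
have s0 : 0 <= s by rewrite (le_trans _ hl)// sqr_ge0.
rewrite -(sqr_sqrtr s0); apply: sqr_bound => //.
by rewrite -ler_sqr ?nnegrE ?nrm_ge0 ?sqrtr_ge0// sqr_sqrtr.
Qed.

Lemma nneg_cvg (u : nat -> A) (l : A) :
  (forall n, nneg (u n)) -> u @ \oo --> l -> nneg l.
Proof.
move=> u0 ul; split; first by apply: sa_cvg ul => n; exact: nneg_sa.
exists (nrm l).
apply: (cvg_nrm_le (u := fun n => (nrm l)%:I - u n)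
  (b := fun n => nrm l + (nrm (u n - l) + nrm (u n - l)))).
- by apply: cvgB ul; exact: cvg_cst.
- rewrite -[X in _ --> X]addr0; apply: cvgD; first exact: cvg_cst.
  by rewrite -[X in _ --> X]addr0; apply: cvgD; exact/cvg_nrmP.
move=> n; set e := nrm (u n - l); have e0 : 0 <= e by exact: nrm_ge0.
have le : nrm (u n) <= nrm l + e.
  by rewrite [leRHS]addrC -[X in nrm X <= _](subrK l) nrmD.
have := nneg_nrm_bound (u0 n) le; rewrite rmorphD/= scalerDl addrAC.
set w := _ - u n => H.
rewrite -[w](addrK (e%:I)) (le_trans (nrmB _ _))// addrA lerD//.
exact: nrm_alg.
Qed.

(** At b = a^* this makes a a^* + a^* a half the sum of the squares of two self-adjoint elements, a
    + a^* and i times a - a^*. *)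
Lemma sqrDB_comm a b :
  (a + b) * (a + b) - (a - b) * (a - b) = (2 : R)%:C *: (a * b + b * a).
Proof.
have DB x y : x + y + (x - y) = x + x by rewrite addrACA subrr addr0.
rewrite scale2C !mulrDr !mulrDl !mulrN !mulNr opprK.
move: (a * a) (a * b) (b * a) (b * b) => P S T Q.
rewrite !opprD !opprK [- P + T]addrC [X in _ + X]addrC [X in X + _]addrC.
by rewrite addrACA DB [P + T]addrC DB addrACA.
Qed.

(* With z = d d^*, v = - d^* d and t = |d|^2, the element d^* (t - z)^2 d has
   norm at most t^3, but equals - (t^2 v + 2 t v^2 + v^3), of norm at least
   2 t |v|^2 = 2 t^3. *)
Lemma nneg_starM_opp d : nneg (- (star d * d)) -> d = 0.
Proof.
set v := - _ => v0; pose z := d * star d.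
have [t tE] : exists t, t = nrm d ^+ 2 by exists (nrm d ^+ 2).
have t0 : 0 <= t by rewrite tE sqr_ge0.
(* d d^* is the sum of d d^* + d^* d, half a sum of two squares, and of v. *)
have z0 : nneg z.
  have -> : z = (2^-1 : R)%:C *: ((d + star d) * (d + star d) +
      ('i *: (d - star d)) * ('i *: (d - star d))) + v.
    rewrite cscalerAl cscalerAr scalerA mulCii scaleN1r.
    rewrite sqrDB_comm scalerA -rmorphM/= mulVf ?pnatr_eq0// scale1r.
    by rewrite /v addrK.
  apply: nnegD v0; apply: nnegZ; first by rewrite invr_ge0.
  apply: nnegD; apply: sqr_nneg; first by rewrite starD starK addrC.
  by rewrite starZi starB starK -scalerN opprB.
have zt : nrm (t%:I - z) <= t.
  apply: nneg_nrm_bound => //; rewrite (le_trans (nrmM _ _))//.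
  by rewrite nrm_star tE expr2.
have ww : (t%:I + v) * v * (t%:I + v) =
    - (star d * ((t%:I - z) * (t%:I - z)) * d).
  have dz : (t%:I - z) * d = d * (t%:I + v).
    by rewrite mulrBl mulrDr cscalerAl cscalerAr mul1r mulr1 mulrN mulrA.
  have zd : star d * (t%:I - z) = (t%:I + v) * star d.
    by rewrite mulrBr mulrDl cscalerAl cscalerAr mul1r mulr1 mulNr mulrA.
  have -> : star d * ((t%:I - z) * (t%:I - z)) * d =
      (t%:I + v) * star d * (d * (t%:I + v)) by rewrite -zd -dz !mulrA.
  rewrite mulrA -[_ * star d * d]mulrA -[star d * d]opprK -/v.
  by rewrite mulrN mulNr opprK.
have wle : nrm ((t%:I + v) * v * (t%:I + v)) <= t * (t * t).
  have -> : t * (t * t) = nrm d * (t * t) * nrm d.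
    by rewrite mulrAC -[nrm d * _]expr2 -tE.
  rewrite ww nrmN (le_trans (nrmM _ _))// ler_wpM2r ?nrm_ge0//.
  rewrite (le_trans (nrmM _ _))// nrm_star ler_wpM2l ?nrm_ge0//.
  by rewrite (le_trans (nrmM _ _))// ler_pM ?nrm_ge0.
have vs := nneg_sa v0.
have vt : nrm v = t by rewrite nrmN nrm_starM tE.
have : nrm ((2 * t)%:C *: (v * v)) <= t * (t * t).
  apply: le_trans wle; apply: nneg_le_nrm.
    by apply: nnegZ; [rewrite mulr_ge0|exact: sqr_nneg].
  have -> : (t%:I + v) * v * (t%:I + v) - (2 * t)%:C *: (v * v) =
    (t * t)%:C *: v + v * v * v.
    have -> : (t%:I + v) * v = t%:C *: v + v * v.
      by rewrite mulrDl cscalerAl mul1r.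
    rewrite mulrDr cscalerAr mulr1 scalerDr mulrDl cscalerAl scalerA -rmorphM/=.
    rewrite [X in X - _]addrA [(2 * t)%:C]rmorphM/= -scalerA scale2C.
    by rewrite [LHS]addrAC -[X in X - _ + _]addrA addrK.
  apply: nnegD; first by apply: nnegZ => //; rewrite mulr_ge0.
  have [g [gs _ <- _]] := nneg_sqrt v0.
  have -> : g * g * (g * g) * (g * g) = (g * g * g) * (g * g * g).
    by rewrite !mulrA.
  by apply: sqr_nneg; rewrite !starMr gs mulrA.
rewrite nrmZ nrm_sa_sqr// vt ger0_norm ?mulr_ge0// => H.
have /eqP : t * (t * t) = 0.
  by have := mulr_ge0 t0 (mulr_ge0 t0 t0); move: H; rewrite expr2; lra.
by rewrite !mulf_eq0 !orbb tE sqrf_eq0 => /eqP/nrm0_eq0.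
Qed.

(* With m = |x| and r = m - x, twice the negative part of x = c^* c, the element
   d = c r satisfies - d^* d = m r^2 >= 0, hence vanishes; this forces r = 0. *)
Lemma starM_nneg c : nneg (star c * c).
Proof.
set x := star c * c.
have xs : star x = x by rewrite starMr starK.
have [m [ms m0 mm mz]] := nneg_sqrt (sqr_nneg xs).
have xm : x * m = m * x by apply: mz; rewrite mulrA.
have [q [qs _ qq qz]] := nneg_sqrt m0.
pose r := m - x.
have rs : star r = r by rewrite starB ms xs.
have rm : r * m = m * r by rewrite mulrBl mulrBr xm.
have rq : r * q = q * r by exact: qz.
have xr : x * r = - (m * r) by rewrite !mulrBr mm xm opprB.
have rqs : star (q * r) = q * r by rewrite starMr qs rs rq.
have mrr : m * r * r = q * r * (q * r).
  by rewrite -qq -!mulrA (mulrA r q) rq !mulrA.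
have dd : star (c * r) * (c * r) = - (m * r * r).
  by rewrite starMr rs -mulrA (mulrA (star c)) -/x xr mulrN mulrA rm.
have d0 : c * r = 0.
  by apply: nneg_starM_opp; rewrite dd opprK mrr; exact: sqr_nneg.
have qr0 : q * r = 0.
  apply: nrm_starM_eq0; rewrite rqs -mrr; apply/eqP.
  by rewrite -oppr_eq0 -dd d0 mulr0.
have mr0 : m * r = 0 by rewrite -qq -mulrA qr0 mulr0.
have r0 : r = 0.
  by apply: nrm_starM_eq0; rewrite rs {1}/r mulrBl xr mr0 oppr0 subr0.
by rewrite (_ : x = m)//; apply/esym/eqP; rewrite -subr_eq0 -/r r0.
Qed.

Lemma cstar_posP a : cstar_pos a <-> nneg a.
Proof.
split=> [[c ->]|/nneg_sqrt[h [hs _ <- _]]]; first exact: starM_nneg.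
by exists h; rewrite hs.
Qed.

Lemma nneg_conj a b : nneg a -> nneg (star b * a * b).
Proof.
move=> /nneg_sqrt[h [hs _ <- _]].
by have := starM_nneg (h * b); rewrite starMr hs !mulrA.
Qed.

End CStarTheory.

(** * Completion of semi-inner product spaces *)

(* No algebraic law is required of the carrier: only its inner products are ever
   observed, so that formal linear combinations need no quotient. *)
Record semiInner (R : realType) (B : cstarAlgType R) := SemiInner {
  si_carrier :> Type;
  si_point : si_carrier;
  si_add : si_carrier -> si_carrier -> si_carrier;
  si_ract : si_carrier -> B -> si_carrier;
  ip : si_carrier -> si_carrier -> B;
  ipDr : forall u v w, ip u (si_add v w) = ip u v + ip u w;
  ipRr : forall u v b, ip u (si_ract v b) = ip u v * b;
  ip_star : forall u v, star (ip u v) = ip v u;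
  ip_nneg : forall v, nneg (ip v v)
}.

Section SemiInnerTheory.
Context (R : realType) (B : cstarAlgType R) (V : semiInner B).
Implicit Types (u v w : V) (b : B).

Definition sn v : R := Num.sqrt (nrm (ip v v)).

Lemma sn_ge0 v : 0 <= sn v.
Proof. exact: sqrtr_ge0. Qed.

Lemma sn_sqr v : sn v ^+ 2 = nrm (ip v v).
Proof. by rewrite sqr_sqrtr// nrm_ge0. Qed.

Lemma ipDl u v w : ip (si_add u v) w = ip u w + ip v w.
Proof. by rewrite -ip_star ipDr starD !ip_star. Qed.

Lemma ipRl u v b : ip (si_ract u b) v = star b * ip u v.
Proof. by rewrite -ip_star ipRr starMr ip_star. Qed.

(** Completing the square with w = v - u y / s. Since <u, u> is not a scalar, s replaces it, and the
    defect y^* (s - <u, u>) y / s^2 is positive: added to <w, w>, it leaves <v, v> - y^* y / s. *)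
Lemma ip_cauchy_sqr (s : R) u v : 0 < s -> nrm (ip u u) <= s ->
  nrm (ip u v) ^+ 2 <= s * nrm (ip v v).
Proof.
move=> s0 us; set y := ip u v; pose r : R := s^-1.
have rs : s * r = 1 by rewrite divff// gt_eqF.
have rrs : r * r * s = r by rewrite -mulrA [r * s]mulrC rs mulr1.
have r0 : 0 < r by rewrite invr_gt0.
pose w := si_add v (si_ract u (- (r%:C *: y))).
have ys : ip v u = star y by rewrite ip_star.
have N : nneg (ip v v - r%:C *: (star y * y)).
  have -> : ip v v - r%:C *: (star y * y) =
      ip w w + (r * r)%:C *: (star y * (s%:C *: (1 : B) - ip u u) * y).
    have e1 : ip w v = ip v v - r%:C *: (star y * y).
      by rewrite ipDl ipRl starN starZr mulNr cscalerAl.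
    have e2 : ip w u * - (r%:C *: y) =
        - (r%:C *: (star y * y)) + (r * r)%:C *: (star y * ip u u * y).
      rewrite ipDl ipRl ys starN starZr mulrN mulrDl opprD !mulNr opprK.
      by rewrite !cscalerAl !cscalerAr scalerA -rmorphM.
    have e3 : (r * r)%:C *: (star y * (s%:C *: (1 : B) - ip u u) * y) =
        r%:C *: (star y * y) - (r * r)%:C *: (star y * ip u u * y).
      rewrite mulrBr mulrBl cscalerAr cscalerAl mulr1 scalerBr scalerA.
      by rewrite -rmorphM/= rrs.
    rewrite ipDr ipRr e1 e2 e3 -[X in _ = _ + X]opprB.
    by rewrite [X in _ = _ + X - _]addrC addrK.
  apply: nnegD; first exact: ip_nneg.
  apply: nnegZ; first by rewrite mulr_ge0// ltW.
  by apply: nneg_conj; apply: nneg_nrmB => //; exact: ip_star.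
have : nrm (r%:C *: (star y * y)) <= nrm (ip v v).
  by apply: nneg_le_nrm => //; apply: nnegZ (ltW r0) _; exact: starM_nneg.
rewrite nrmZ gtr0_norm// nrm_starM => H.
by rewrite -[leLHS]mul1r -rs -mulrA ler_wpM2l// ltW.
Qed.

Lemma ip_cauchy u v : nrm (ip u v) <= sn u * sn v.
Proof.
rewrite -ler_sqr ?nnegrE ?nrm_ge0 ?mulr_ge0 ?sn_ge0// exprMn !sn_sqr.
have := nrm_ge0 (ip u u); rewrite le_eqVlt => /orP[/eqP u0|u0]; last first.
  exact: ip_cauchy_sqr.
rewrite -u0 mul0r leNgt; apply/negP => y0.
have q0 := nrm_ge0 (ip v v); set q := nrm (ip v v) in q0 *.
have q1 : 0 < q + 1 by lra.
(* When <u, u> = 0 every s > 0 is admissible; this one bounds |<u, v>|^2 by q / (q + 1) times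
   itself, a contradiction. *)
have := @ip_cauchy_sqr (nrm (ip u v) ^+ 2 / (q + 1)) u v.
rewrite -u0 divr_gt0// ltW ?divr_gt0// => /(_ isT isT).
rewrite -/q mulrAC ler_pdivlMr// => H; nra.
Qed.

End SemiInnerTheory.

(** The laws of the action are imposed inside inner products only: on lists of generators, acting by
    a + b differs from concatenating the actions of a and b, but has the same inner products. *)
Record preHilbert (R : realType) (A B : cstarAlgType R) := PreHilbert {
  ph_semi :> semiInner B;
  ph_lact : A -> ph_semi -> ph_semi;
  ph_adj : forall a u v, ip (ph_lact a u) v = ip u (ph_lact (star a) v);
  ph_D : forall a b u v,
    ip u (ph_lact (a + b) v) = ip u (ph_lact a v) + ip u (ph_lact b v);
  ph_Z : forall (l : R[i]) a u v,
    ip u (ph_lact (l *: a) v) = l *: ip u (ph_lact a v);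
  ph_M : forall a b u v,
    ip u (ph_lact (a * b) v) = ip u (ph_lact a (ph_lact b v));
  ph_1 : forall u v, ip u (ph_lact 1 v) = ip u v
}.

(** Since |a|^2 - a^* a = c^2 with c self-adjoint, |a|^2 <v, v> - <a v, a v> = <c v, c v> is
    positive. *)
Lemma sn_lact (R : realType) (A B : cstarAlgType R) (V : preHilbert A B)
  (a : A) (v : V) : sn (ph_lact a v) <= nrm a * sn v.
Proof.
rewrite -ler_sqr ?nnegrE ?mulr_ge0 ?nrm_ge0 ?sn_ge0// exprMn !sn_sqr.
have : nneg ((nrm a ^+ 2)%:C *: (1 : A) - star a * a).
  apply: nneg_nrmB; first by rewrite starMr starK.
  by rewrite nrm_starM.
move=> /nneg_sqrt[c [cs _ cc _]].
have cE : ip (ph_lact c v) (ph_lact c v) =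
    (nrm a ^+ 2)%:C *: ip v v - ip (ph_lact a v) (ph_lact a v).
  rewrite !ph_adj -!ph_M cs cc ph_D ph_Z ph_1; congr (_ + _).
  by rewrite -scaleN1r ph_Z scaleN1r.
have := ip_nneg (ph_lact c v); rewrite cE => /(nneg_le_nrm (ip_nneg _)).
by rewrite nrmZ ger0_norm ?sqr_ge0.
Qed.

(* The completion of V is realized as the space of functionals on V that are
   approximated by the functionals <., v> in operator norm; it is Hausdorff
   and complete without any quotient. *)
Section Completion.
Context (R : realType) (B : cstarAlgType R) (V : semiInner B).
Implicit Types (u v w : V) (b : B) (e : R).

Definition approx (f : V -> B) v e := forall w, nrm (f w - ip w v) <= e * sn w.

Definition hcompl_pred : {pred V -> B} :=
  fun f => `[< forall e, 0 < e -> exists v, approx f v e >].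

Lemma ip0r u v : ip u (si_ract v 0) = 0.
Proof. by rewrite ipRr mulr0. Qed.

Lemma approxD f g u v e e' :
  approx f u e -> approx g v e' -> approx (f + g) (si_add u v) (e + e').
Proof.
move=> fu gv w; rewrite ipDr opprD addrACA mulrDl.
by rewrite (le_trans (nrmD _ _))// lerD.
Qed.

Lemma approxZ (l : R[i]) f v e : approx f v e ->
  approx (l *: f) (si_ract v (l *: (1 : B))) (complex.Re `|l| * e).
Proof.
move=> fv w; rewrite ipRr cscalerAr mulr1.
rewrite -[(l *: f) w]/(l *: f w) -scalerBr nrmZc -mulrA ler_wpM2l//.
exact: Re_norm_ge0.
Qed.

Fact hcompl_submod_closed : submod_closed hcompl_pred.
Proof.
split=> [|l f g /asboolP fa /asboolP ga]; apply/asboolP => e e0.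
  exists (si_ract (si_point V) 0) => w.
  by rewrite ip0r subrr nrm0 mulr_ge0 ?sn_ge0// ltW.
have l0 := Re_norm_ge0 l.
set c := complex.Re `|l| in l0 *.
have c1 : 0 < c + 1 by lra.
have [u ua] := fa (e / (c + 1) / 2) ltac:(by rewrite !divr_gt0).
have [v va] := ga (e / 2) ltac:(by rewrite divr_gt0).
exists (si_add (si_ract u (l *: (1 : B))) v) => w.
have := approxD (approxZ l ua) va w; rewrite -/c => /le_trans; apply.
rewrite ler_wpM2r ?sn_ge0// mulrA -mulrDl ler_pdivrMr// mulr_natr mulr2n lerD2r.
by rewrite mulrCA ger_pMr// ler_pdivrMr// mul1r lerDl.
Qed.

HB.instance Definition _ := GRing.isSubmodClosed.Build R[i] (V -> B)
  hcompl_pred hcompl_submod_closed.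

Record hcompl := HCompl { hfun :> V -> B; _ : hfun \in hcompl_pred }.

HB.instance Definition _ := [isSub for hfun].
HB.instance Definition _ := [Choice of hcompl by <:].
HB.instance Definition _ := [SubChoice_isSubLmodule of hcompl by <:].

Implicit Types f g : hcompl.

Lemma hcomplP f e : 0 < e -> exists v, approx f v e.
Proof. by case: f => f /= /asboolP; apply. Qed.

Lemma hcompl_eq f g : (forall w, f w = g w) -> f = g.
Proof. by move=> fg; apply/val_inj/funext. Qed.

Lemma hfunD f g w : (f + g) w = f w + g w. Proof. by []. Qed.
Lemma hfunN f w : (- f) w = - f w. Proof. by []. Qed.
Lemma hfunZ (l : R[i]) f w : (l *: f) w = l *: f w. Proof. by []. Qed.

Lemma le_eps0 (x c : R) : (forall e, 0 < e -> x <= e * c) -> x <= 0.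
Proof.
move=> xe; rewrite leNgt; apply/negP => x0.
have c1 : 0 < `|c| + 1 by rewrite ltr_wpDl.
have := xe (x / (2 * (`|c| + 1))) ltac:(by rewrite divr_gt0// mulr_gt0).
have := ler_norm c => H1 H2.
suff : x / (2 * (`|c| + 1)) * c < x by rewrite ltNge H2.
rewrite mulrAC ltr_pdivrMr ?mulr_gt0//; nra.
Qed.

(** A relation that holds against every v passes to limits of the functionals <., v>. In this way f
    respects relations between vectors although V obeys no laws. *)
Lemma hfun_eqD f w w1 w2 :
  (forall v, ip w v = ip w1 v + ip w2 v) -> f w = f w1 + f w2.
Proof.
move=> wE; apply/subr0_eq/nrm0_eq0/le_anti; rewrite nrm_ge0 andbT.
apply: (@le_eps0 _ (sn w + sn w1 + sn w2)) => e e0; have [v va] := hcomplP f e0.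
have -> : f w - (f w1 + f w2) =
    (f w - ip w v) - (f w1 - ip w1 v) - (f w2 - ip w2 v).
  by rewrite wE !opprB -addrA [X in _ = _ + X]addrACA [RHS]addrA subrK -opprD.
by rewrite !mulrDr (le_trans (nrmB _ _))// lerD// (le_trans (nrmB _ _))// lerD.
Qed.

Lemma hfun_eqM f b w w1 : (forall v, ip w v = b * ip w1 v) -> f w = b * f w1.
Proof.
move=> wE; apply/subr0_eq/nrm0_eq0/le_anti; rewrite nrm_ge0 andbT.
apply: (@le_eps0 _ (sn w + nrm b * sn w1)) => e e0.
have [v va] := hcomplP f e0.
have -> : f w - b * f w1 = (f w - ip w v) - b * (f w1 - ip w1 v).
  by rewrite wE mulrBr opprB addrA subrK.
rewrite [leRHS]mulrDr (le_trans (nrmB _ _))// lerD//.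
rewrite (le_trans (nrmM _ _))// mulrCA.
by rewrite ler_wpM2l ?nrm_ge0.
Qed.

Lemma hfun_eq f w w1 : (forall v, ip w v = ip w1 v) -> f w = f w1.
Proof.
by move=> wE; rewrite -[RHS]mul1r; apply: hfun_eqM => v; rewrite mul1r.
Qed.

Fact appr_subproof f (n : nat) : exists v, approx f v n.+1%:R^-1.
Proof. by apply: hcomplP; rewrite invr_gt0. Qed.

Definition appr f (n : nat) : V := projT1 (cid (appr_subproof f n)).

Lemma apprP f n : approx f (appr f n) n.+1%:R^-1.
Proof. by rewrite /appr; case: cid. Qed.

(** Convergence of the vectors u n to f in operator norm, phrased before the completion carries a
    norm. *)
Definition conv (u : nat -> V) f := exists r : nat -> R,
  [/\ forall n, 0 <= r n, r @ \oo --> (0 : R) & forall n, approx f (u n) (r n)].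

Lemma conv_appr f : conv (appr f) f.
Proof.
exists (fun n => n.+1%:R^-1); split=> [n||];
  [by rewrite invr_ge0|exact: cvg_harmonic|exact: apprP].
Qed.

Lemma hfun_bounded f : exists2 M : R, 0 <= M & forall w, nrm (f w) <= M * sn w.
Proof.
have [v va] := hcomplP f ltr01; exists (1 + sn v).
  by rewrite addr_ge0 ?sn_ge0.
move=> w; rewrite -(subrK (ip w v) (f w)) (le_trans (nrmD _ _))//.
by rewrite mulrDl lerD// mulrC ip_cauchy.
Qed.

Lemma sn_approx f v e M : approx f v e -> (forall w, nrm (f w) <= M * sn w) ->
  0 <= M + e -> sn v <= M + e.
Proof.
move=> fv fM Me; have [v0|v0] := leP (sn v) 0; first exact: le_trans Me.
rewrite -(ler_pM2r v0) -expr2 sn_sqr mulrDl.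
rewrite -[ip v v](subKr (f v)) (le_trans (nrmB _ _))// lerD//.
Qed.

(** For w = u - v, both <., u> and <., v> approximate f at w, so |w|^2 <= (e + e') |w|. Hence g is
    Cauchy along approximants of f. *)
Lemma approx_diff f g u v e e' M : 0 <= M ->
  (forall w, nrm (g w) <= M * sn w) ->
  0 <= e -> 0 <= e' -> approx f u e -> approx f v e' ->
  nrm (g u - g v) <= M * (e + e').
Proof.
move=> M0 gM e0 e'0 fu fv; pose w := si_add u (si_ract v (-1)).
have wE z : ip w z = ip u z - ip v z.
  by rewrite ipDl ipRl starN star1 mulN1r.
have -> : g u - g v = g w.
  rewrite (@hfun_eqD g w u (si_ract v (-1))); last by move=> z; rewrite ipDl.
  rewrite (@hfun_eqM g (-1) (si_ract v (-1)) v) ?mulN1r// => z.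
  by rewrite ipRl starN star1.
rewrite (le_trans (gM w))// ler_wpM2l//.
have [w0|w0] := leP (sn w) 0; first by rewrite (le_trans w0)// addr_ge0.
rewrite -(ler_pM2r w0) -expr2 sn_sqr.
have -> : ip w w = (f w - ip w v) - (f w - ip w u).
  rewrite opprB addrC [_ - f w + _]addrA subrK.
  by rewrite ipDr ipRr mulrN mulr1.
by rewrite (le_trans (nrmB _ _))// addrC mulrDl lerD.
Qed.

(** As g v stands for <v, g>, this is the limit of <v_n, g> over approximants v_n of f;
    [hinner_conv] gives independence of their choice. *)
Definition hinner f g : B := lim ((fun n => g (appr f n)) @ \oo).

Lemma hinner_appr f g : (fun n => g (appr f n)) @ \oo --> hinner f g.
Proof.
have [M M0 gM] := hfun_bounded g.
have [n m nm|l fl] := @cauchy_rate_cvg _ _ (fun n => g (appr f n)) (M * 2).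
  have := approx_diff M0 gM _ _ (apprP f m) (apprP f n).
  rewrite !invr_ge0 !ler0n => /(_ isT isT)/le_trans; apply.
  rewrite -mulrA ler_wpM2l// mulr_natl mulr2n lerD2r.
  by rewrite lef_pV2 ?posrE// ler_nat ltnS.
by rewrite /hinner (cvg_lim _ fl).
Qed.

Lemma hinner_conv (u : nat -> V) f g :
  conv u f -> (fun n => g (u n)) @ \oo --> hinner f g.
Proof.
move=> [r [r0 rl fu]]; have [M M0 gM] := hfun_bounded g.
apply: (cvg_squeeze (b := fun n =>
  M * (r n + n.+1%:R^-1) + nrm (g (appr f n) - hinner f g))).
  move=> n; rewrite (le_trans (nrm_tri _ (g (appr f n)) _))// lerD2r.
  by apply: approx_diff (fu n) (apprP f n); rewrite ?invr_ge0.
rewrite -[0](addr0 0); apply: cvgD.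
  rewrite -(mulr0 M); apply: cvgM; first exact: cvg_cst.
  by rewrite -[0](addr0 0); apply: cvgD => //; exact: cvg_harmonic.
by apply/cvg_nrmP; exact: hinner_appr.
Qed.

Lemma hinner_conv2 (u v : nat -> V) f g : conv u f -> conv v g ->
  (fun n => ip (u n) (v n)) @ \oo --> hinner f g.
Proof.
move=> uf [r [r0 rl gv]]; have ug := @hinner_conv _ f g uf.
move: uf => [s [s0 sl fu]]; have [M M0 fM] := hfun_bounded f.
apply: (cvg_squeeze (b := fun n =>
  r n * (M + s n) + nrm (g (u n) - hinner f g))).
  move=> n; rewrite (le_trans (nrm_tri _ (g (u n)) _))// lerD2r nrmC.
  rewrite (le_trans (gv n _))// ler_wpM2l//.
  by apply: sn_approx (fu n) fM _; rewrite addr_ge0.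
rewrite -[0](addr0 0); apply: cvgD; last exact/cvg_nrmP.
rewrite -(mul0r (M + 0)); apply: cvgM => //.
by apply: cvgD => //; exact: cvg_cst.
Qed.

Lemma hinner_star f g : star (hinner f g) = hinner g f.
Proof.
have := hinner_conv2 (conv_appr g) (conv_appr f).
have := cvg_star (hinner_conv2 (conv_appr f) (conv_appr g)).
rewrite (_ : _ \o _ = fun n => ip (appr g n) (appr f n)).
  exact: cvg_seq_unique.
by apply/funext => n /=; rewrite ip_star.
Qed.

Lemma hinner_nneg f : nneg (hinner f f).
Proof.
apply: nneg_cvg (hinner_conv2 (conv_appr f) (conv_appr f)) => n.
exact: ip_nneg.
Qed.

Definition hnorm f : R := Num.sqrt (nrm (hinner f f)).

Lemma hnorm_ge0 f : 0 <= hnorm f.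
Proof. exact: sqrtr_ge0. Qed.

Lemma hnorm_sqr f : hnorm f ^+ 2 = nrm (hinner f f).
Proof. by rewrite sqr_sqrtr// nrm_ge0. Qed.

Lemma cvg_sn_sqr (u : nat -> V) f : conv u f ->
  (fun n => sn (u n) ^+ 2) @ \oo --> hnorm f ^+ 2.
Proof.
move=> uf; rewrite hnorm_sqr.
rewrite (_ : (fun n => _) = (fun n => nrm (ip (u n) (u n)))).
  exact: cvg_nrm (hinner_conv2 uf uf).
by apply/funext => n; rewrite sn_sqr.
Qed.

Lemma hfun_le f w : nrm (f w) <= hnorm f * sn w.
Proof.
have cf := conv_appr f.
rewrite -ler_sqr ?nnegrE ?mulr_ge0 ?nrm_ge0 ?hnorm_ge0 ?sn_ge0// exprMn.
have fw : (fun n => ip w (appr f n)) @ \oo --> f w.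
  apply: (cvg_squeeze (b := fun n => sn w * n.+1%:R^-1)).
    by move=> n; rewrite nrmC mulrC apprP.
  exact: cvg_harmonicMl.
apply: (ler_cvg_to (cvgM (cvg_nrm fw) (cvg_nrm fw))
  (cvgM (cvg_sn_sqr cf) (cvg_cst (sn w ^+ 2)))).
near=> n; rewrite /= -expr2 -exprMn.
by rewrite ler_sqr ?nnegrE ?mulr_ge0 ?nrm_ge0 ?sn_ge0// mulrC ip_cauchy.
Unshelve. all: by end_near. Qed.

(** Along approximants u_n of f, f (u_n) tends to <f, f> and is bounded by M |u_n|. Together with
    [hfun_le] this makes [hnorm] the operator norm of f, so norm estimates reduce to pointwise
    ones. *)
Lemma hnorm_le f (M : R) : 0 <= M -> (forall w, nrm (f w) <= M * sn w) ->
  hnorm f <= M.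
Proof.
move=> M0 fM; have [f0|f0] := leP (hnorm f) 0; first exact: le_trans M0.
suff : hnorm f ^+ 2 * hnorm f ^+ 2 <= M ^+ 2 * hnorm f ^+ 2.
  by rewrite ler_pM2r ?exprn_gt0// ler_sqr ?nnegrE ?hnorm_ge0.
rewrite {1 2}hnorm_sqr.
have cf := conv_appr f; have ff := cvg_nrm (@hinner_conv _ f f cf).
apply: (ler_cvg_to (cvgM ff ff) (cvgM (cvg_cst (M ^+ 2)) (cvg_sn_sqr cf))).
near=> n; rewrite /= -expr2 -exprMn.
by rewrite ler_sqr ?nnegrE ?mulr_ge0 ?nrm_ge0 ?sn_ge0.
Unshelve. all: by end_near. Qed.

Lemma hnormD f g : hnorm (f + g) <= hnorm f + hnorm g.
Proof.
apply: hnorm_le => [|w]; first by rewrite addr_ge0 ?hnorm_ge0.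
by rewrite hfunD (le_trans (nrmD _ _))// mulrDl lerD// hfun_le.
Qed.

Lemma hnormZ (l : R[i]) f : hnorm (l *: f) = complex.Re `|l| * hnorm f.
Proof.
have l0 := Re_norm_ge0 l; apply/le_anti/andP; split.
  apply: hnorm_le => [|w]; first by rewrite mulr_ge0 ?hnorm_ge0.
  by rewrite hfunZ nrmZc -mulrA ler_wpM2l// hfun_le.
have [l1|l1] := leP (complex.Re `|l|) 0.
  by rewrite (le_trans _ (hnorm_ge0 _))// mulr_le0_ge0 ?hnorm_ge0.
rewrite -ler_pdivlMl//; apply: hnorm_le => [|w].
  by rewrite mulr_ge0 ?hnorm_ge0// invr_ge0 ltW.
by rewrite -mulrA ler_pdivlMl// -nrmZc -hfunZ hfun_le.
Qed.

Lemma hnorm0_eq0 f : hnorm f = 0 -> f = 0.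
Proof.
move=> f0; apply: hcompl_eq => w; apply/nrm0_eq0/le_anti.
by rewrite nrm_ge0 andbT (le_trans (hfun_le f w))// f0 mul0r.
Qed.

Fact hnormC_D f g : (hnorm (f + g))%:C <= (hnorm f)%:C + (hnorm g)%:C.
Proof. by rewrite -rmorphD/= lecR hnormD. Qed.

Fact hnormC_Z (l : R[i]) f : (hnorm (l *: f))%:C = `|l| * (hnorm f)%:C.
Proof. by rewrite hnormZ -{2}(Re_normC l) -rmorphM. Qed.

Fact hnormC_eq0 f : (hnorm f)%:C = 0 -> f = 0.
Proof. by move=> /complexI; exact: hnorm0_eq0. Qed.

HB.instance Definition _ := Lmodule_isNormed.Build R[i] hcompl
  hnormC_D hnormC_Z hnormC_eq0.

Lemma nrm_hnorm f : nrm f = hnorm f. Proof. by []. Qed.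

(** Centres of balls of radius 1 / (n + 1) belonging to F converge pointwise, at a rate proportional
    to [sn w]; this uniformity keeps the limit approximable by vectors and makes F converge to
    it. *)
Lemma hcompl_complete (F : set_system hcompl) :
  ProperFilter F -> cauchy F -> cvg F.
Proof.
move=> FF /cauchyP Fc.
have /choice[x Fx] : forall n : nat, exists x : hcompl,
    F (ball x (n.+1%:R^-1 : R)%:C).
  by move=> n; apply: Fc; rewrite ltcR invr_gt0.
have xx n m : nrm (x n - x m) <= n.+1%:R^-1 + m.+1%:R^-1.
  have [g [ng mg]] := filter_ex (filterI (Fx n) (Fx m)).
  rewrite (le_trans (nrm_tri _ g _))// lerD//.
    by move/ball_nrm: ng => /ltW.
  by rewrite nrmC; move/ball_nrm: mg => /ltW.
have xw n m w : nrm (x n w - x m w) <= (n.+1%:R^-1 + m.+1%:R^-1) * sn w.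
  rewrite -[_ - _]/((x n - x m) w) (le_trans (hfun_le _ _))//.
  by rewrite ler_wpM2r ?sn_ge0// -nrm_hnorm.
have /choice[f xf] : forall w, exists l : B, (fun n => x n w) @ \oo --> l.
  move=> w; apply: (@cauchy_rate_cvg _ _ _ (2 * sn w)) => n m nm.
  rewrite (le_trans (xw m n w))// mulrAC ler_wpM2r ?sn_ge0//.
  by rewrite mulr_natl mulr2n lerD2r lef_pV2 ?posrE// ler_nat ltnS.
have xfle n w : nrm (x n w - f w) <= n.+1%:R^-1 * sn w.
  apply: (cvg_nrm_le (u := fun m => x n w - x m w)
    (b := fun m => (n.+1%:R^-1 + m.+1%:R^-1) * sn w)) => //.
  - by apply: cvgB (xf w); exact: cvg_cst.
  - apply: cvgM; last exact: cvg_cst.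
    rewrite -[X in _ --> X]addr0; apply: cvgD; first exact: cvg_cst.
    exact: cvg_harmonic.
have fP : f \in hcompl_pred.
  apply/asboolP => e e0.
  have [|n ne] := @harmonic_lt R (e / 2); first by rewrite divr_gt0.
  have [v va] := @hcomplP (x n) (e / 2) ltac:(by rewrite divr_gt0).
  exists v => w; rewrite (le_trans (nrm_tri _ (x n w) _))//.
  rewrite [e in leRHS]splitr mulrDl lerD//.
  by rewrite nrmC (le_trans (xfle n w))// ler_wpM2r ?sn_ge0// ltW.
apply/cvg_ex; exists (HCompl fP).
apply/fcvgrPdist_lt => e e0.
have er : e \is Num.real by rewrite gtr0_real.
move: e0; rewrite -(RRe_real er) ltcR; move: (complex.Re e) => {er}e e0.
have [|n ne] := @harmonic_lt R (e / 2); first by rewrite divr_gt0.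
apply: filterS (Fx n) => g /ball_nrm ng; rewrite nrmE ltcR.
rewrite (le_lt_trans (nrm_tri _ (x n) _))// [ltRHS]splitr ler_ltD//.
  rewrite nrmC nrm_hnorm hnorm_le ?divr_ge0 ?(ltW e0)// => w.
  by rewrite hfunD hfunN (le_trans (xfle n w))// ler_wpM2r ?sn_ge0// ltW.
exact: lt_trans ng ne.
Qed.

HB.instance Definition _ := Uniform_isComplete.Build hcompl hcompl_complete.

Fact hract_subproof f b : (fun w => f w * b) \in hcompl_pred.
Proof.
apply/asboolP => e e0; have b1 : 0 < nrm b + 1 by rewrite ltr_wpDl ?nrm_ge0.
have [v va] := @hcomplP f (e / (nrm b + 1)) ltac:(by rewrite divr_gt0).
exists (si_ract v b) => w; rewrite ipRr -mulrBl (le_trans (nrmM _ _))//.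
have := ler_wpM2r (nrm_ge0 b) (va w) => /le_trans; apply.
rewrite mulrAC ler_wpM2r ?sn_ge0// mulrAC ler_pdivrMr// ler_wpM2l ?(ltW e0)//.
by rewrite lerDl.
Qed.

Definition hract f b := HCompl (hract_subproof f b).

Fact hract1 f : hract f 1 = f.
Proof. by apply: hcompl_eq => w; rewrite /= mulr1. Qed.
Fact hractM f b c : hract f (b * c) = hract (hract f b) c.
Proof. by apply: hcompl_eq => w; rewrite /= mulrA. Qed.
Fact hractDl f g b : hract (f + g) b = hract f b + hract g b.
Proof. by apply: hcompl_eq => w; rewrite /= mulrDl. Qed.
Fact hractDr f b c : hract f (b + c) = hract f b + hract f c.
Proof. by apply: hcompl_eq => w; rewrite /= mulrDr. Qed.
Fact hractZl (l : R[i]) f b : hract (l *: f) b = l *: hract f b.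
Proof. by apply: hcompl_eq => w; rewrite /= cscalerAl. Qed.
Fact hractZr (l : R[i]) f b : hract f (l *: b) = l *: hract f b.
Proof. by apply: hcompl_eq => w; rewrite /= cscalerAr. Qed.

Fact hinnerDr f g h : hinner f (g + h) = hinner f g + hinner f h.
Proof.
apply: cvg_seq_unique (@hinner_appr f (g + h)) _.
by apply: cvgD; exact: hinner_appr.
Qed.

Fact hinnerZr (l : R[i]) f g : hinner f (l *: g) = l *: hinner f g.
Proof.
apply: cvg_seq_unique (@hinner_appr f (l *: g)) _.
by apply: cvgZr; exact: hinner_appr.
Qed.

Fact hinner_ract f g b : hinner f (hract g b) = hinner f g * b.
Proof.
apply: cvg_seq_unique (@hinner_appr f (hract g b)) _.
apply: (cvg_squeeze (b := fun n => nrm (g (appr f n) - hinner f g) * nrm b)).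
  by move=> n; rewrite /= -mulrBl nrmM.
rewrite -(mul0r (nrm b)); apply: cvgM; last exact: cvg_cst.
by apply/cvg_nrmP; exact: hinner_appr.
Qed.

Fact hinner_pos f : cstar_pos (hinner f f).
Proof. exact/cstar_posP/hinner_nneg. Qed.

Fact hinner_def f : hinner f f = 0 -> f = 0.
Proof. by move=> f0; apply: hnorm0_eq0; rewrite /hnorm f0 nrm0 sqrtr0. Qed.

Fact hinner_norm f : `|f| ^+ 2 = `|hinner f f|.
Proof. by rewrite !nrmE -rmorphXn/= nrm_hnorm hnorm_sqr. Qed.

HB.instance Definition _ := isHilbertModule.Build R B hcompl
  hract1 hractM hractDl hractDr hractZl hractZr hinnerDr hinnerZr
  hinner_ract hinner_star hinner_pos hinner_def hinner_norm.

Fact embed_subproof v : (fun w => ip w v) \in hcompl_pred.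
Proof.
apply/asboolP => e e0; exists v => w.
by rewrite subrr nrm0 mulr_ge0 ?sn_ge0// ltW.
Qed.

Definition embed v := HCompl (embed_subproof v).

Lemma inner_embed v g : inner (embed v) g = g v.
Proof.
have cv : conv (fun=> v) (embed v).
  exists (fun=> 0); split=> [//||n w]; first exact: cvg_cst.
  by rewrite /= subrr nrm0 mul0r.
exact: cvg_seq_unique (@hinner_conv _ _ g cv) (cvg_cst _).
Qed.

Section Extension.
Variables (T S : V -> V) (M : R).
Hypotheses (TS : forall u v, ip (T u) v = ip u (S v)).
Hypotheses (SM : forall v, sn (S v) <= M * sn v).

(** The extension of T must satisfy <w, T f> = <S w, f>, so it is precomposition with S; the bound
    is accordingly placed on S. *)
Lemma approx_ext f v e :
  0 <= e -> approx f v e -> approx (f \o S) (T v) (e * M).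
Proof.
move=> e0 fv w.
have -> : ip w (T v) = ip (S w) v by rewrite -ip_star TS ip_star.
by rewrite (le_trans (fv _))// -mulrA ler_wpM2l.
Qed.

Fact ext_subproof f : f \o S \in hcompl_pred.
Proof.
apply/asboolP => e e0; have M1 : 0 < `|M| + 1 by rewrite ltr_wpDl.
have [v va] := @hcomplP f (e / (`|M| + 1)) ltac:(by rewrite divr_gt0).
exists (T v) => w.
rewrite (le_trans (approx_ext (divr_ge0 (ltW e0) (ltW M1)) va w))//.
rewrite ler_wpM2r ?sn_ge0// mulrAC ler_pdivrMr// ler_wpM2l ?(ltW e0)//.
by rewrite (le_trans (ler_norm _))// lerDl.
Qed.

Definition ext f := HCompl (ext_subproof f).

Lemma ext_embed v : ext (embed v) = embed (T v).
Proof. by apply: hcompl_eq => w; rewrite /= -ip_star -TS ip_star. Qed.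

Lemma hnorm_ext f : 0 <= M -> hnorm (ext f) <= M * hnorm f.
Proof.
move=> M0; apply: hnorm_le; first by rewrite mulr_ge0 ?hnorm_ge0.
move=> w; rewrite /= (le_trans (hfun_le _ _))// mulrAC [leRHS]mulrC.
by rewrite ler_wpM2l ?hnorm_ge0.
Qed.

(** Here h is the image of g under the extended adjoint. If v_n approximates f, then T v_n
    approximates [ext f], and g (T v_n) = h v_n passes to the limit. *)
Lemma inner_ext f g (h : hcompl) : (forall w, h w = g (T w)) ->
  inner (ext f) g = inner f h.
Proof.
move=> hE; have [r [r0 rl ra]] := conv_appr f.
have cT : conv (T \o appr f) (ext f).
  exists (fun n => r n * `|M|); split=> [n||n w]; first by rewrite mulr_ge0.
    by rewrite -(mul0r `|M|); apply: cvgM => //; exact: cvg_cst.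
  rewrite (le_trans (approx_ext _ (ra n) w))// ler_wpM2r ?sn_ge0//.
  by rewrite ler_wpM2l// ler_norm.
apply: cvg_seq_unique (@hinner_conv _ _ g cT) _.
rewrite (_ : (fun n => _) = (fun n => h (appr f n))).
  exact: hinner_appr.
by apply/funext => n; rewrite hE.
Qed.

End Extension.
End Completion.

(** * Kernels and Kolmogorov decompositions *)

Section PreHilbertTheory.
Context (R : realType) (A B : cstarAlgType R) (V : preHilbert A B).
Implicit Types (a b : A) (u v w : V) (f g : hcompl V).

Lemma ph_Dl a b u v :
  ip (ph_lact (a + b) u) v = ip (ph_lact a u) v + ip (ph_lact b u) v.
Proof. by rewrite -ip_star ph_D starD !ip_star. Qed.

Lemma ph_Zl (l : R[i]) a u v :
  ip (ph_lact (l *: a) u) v = l^* *: ip (ph_lact a u) v.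
Proof. by rewrite -ip_star ph_Z starZ ip_star. Qed.

Lemma ph_Ml a b u v :
  ip (ph_lact (a * b) u) v = ip (ph_lact a (ph_lact b u)) v.
Proof. by rewrite -ip_star ph_M ip_star. Qed.

Lemma ph_1l u v : ip (ph_lact 1 u) v = ip u v.
Proof. by rewrite -ip_star ph_1 ip_star. Qed.

Definition hlact a : hcompl V -> hcompl V :=
  ext (ph_adj a) (sn_lact (star a)).

Fact hlactD a b f : hlact (a + b) f = hlact a f + hlact b f.
Proof.
apply: hcompl_eq => w; rewrite hfunD /=.
by apply: hfun_eqD => v; rewrite starD ph_Dl.
Qed.

Fact hlactZ (l : R[i]) a f : hlact (l *: a) f = l *: hlact a f.
Proof.
apply: hcompl_eq => w; rewrite hfunZ /= -[f _ in RHS]mul1r -cscalerAl.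
by apply: hfun_eqM => v; rewrite starZ ph_Zl conjCK cscalerAl mul1r.
Qed.

Fact hlactM a b f : hlact (a * b) f = hlact a (hlact b f).
Proof.
apply: hcompl_eq => w /=.
by apply: hfun_eq => v; rewrite starMr ph_Ml.
Qed.

Fact hlact1 f : hlact 1 f = f.
Proof.
by apply: hcompl_eq => w /=; apply: hfun_eq => v; rewrite star1 ph_1l.
Qed.

Fact hlact_star a : is_adjoint (hlact a) (hlact (star a)).
Proof. by move=> f g; apply: inner_ext => w; rewrite /= starK. Qed.

HB.instance Definition _ := isCorrespondence.Build R A B (hcompl V)
  hlactD hlactZ hlactM hlact1 hlact_star.

End PreHilbertTheory.

(** * Direct sums and their sign operator *)

Section ProductSpace.
Context (R : realType) (A B : cstarAlgType R) (V W : preHilbert A B).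
Local Notation VW := (V * W)%type.

Definition prod_add (u v : VW) : VW := (si_add u.1 v.1, si_add u.2 v.2).
Definition prod_ract (u : VW) (b : B) : VW := (si_ract u.1 b, si_ract u.2 b).
Definition prod_ip (u v : VW) : B := ip u.1 v.1 + ip u.2 v.2.
Definition prod_lact (a : A) (u : VW) : VW := (ph_lact a u.1, ph_lact a u.2).

Fact prod_ipDr u v w : prod_ip u (prod_add v w) = prod_ip u v + prod_ip u w.
Proof. by rewrite /prod_ip !ipDr addrACA. Qed.

Fact prod_ipRr u v b : prod_ip u (prod_ract v b) = prod_ip u v * b.
Proof. by rewrite /prod_ip !ipRr mulrDl. Qed.

Fact prod_ip_star u v : star (prod_ip u v) = prod_ip v u.
Proof. by rewrite /prod_ip starD !ip_star. Qed.

Fact prod_ip_nneg v : nneg (prod_ip v v).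
Proof. by apply: nnegD; exact: ip_nneg. Qed.

Definition prod_semi := SemiInner (si_point V, si_point W)
  prod_ipDr prod_ipRr prod_ip_star prod_ip_nneg.

Fact prod_adj a (u v : prod_semi) :
  ip (prod_lact a u : prod_semi) v = ip u (prod_lact (star a) v : prod_semi).
Proof. by rewrite /= /prod_ip !ph_adj. Qed.

Fact prod_lactD a b (u v : prod_semi) : ip u (prod_lact (a + b) v : prod_semi) =
  ip u (prod_lact a v : prod_semi) + ip u (prod_lact b v : prod_semi).
Proof. by rewrite /= /prod_ip !ph_D addrACA. Qed.

Fact prod_lactZ (l : R[i]) a (u v : prod_semi) :
  ip u (prod_lact (l *: a) v : prod_semi) =
  l *: ip u (prod_lact a v : prod_semi).
Proof. by rewrite /= /prod_ip !ph_Z scalerDr. Qed.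

Fact prod_lactM a b (u v : prod_semi) : ip u (prod_lact (a * b) v : prod_semi) =
  ip u (prod_lact a (prod_lact b v) : prod_semi).
Proof. by rewrite /= /prod_ip !ph_M. Qed.

Fact prod_lact1 (u v : prod_semi) : ip u (prod_lact 1 v : prod_semi) = ip u v.
Proof. by rewrite /= /prod_ip !ph_1. Qed.

Definition prod_preHilbert :=
  @PreHilbert R A B prod_semi prod_lact prod_adj prod_lactD prod_lactZ
  prod_lactM prod_lact1.

(** The carrier has no opposite, so the sign on the second summand is the right action of -1. *)
Definition prod_sign (u : prod_preHilbert) : prod_preHilbert :=
  (u.1, si_ract u.2 (-1)).

Lemma prod_sign_adj (u v : prod_preHilbert) :
  ip (prod_sign u) v = ip u (prod_sign v).
Proof. by rewrite /= /prod_ip /= ipRl ipRr starN star1 mulN1r mulrN1. Qed.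

Lemma prod_signK (u v : prod_preHilbert) :
  ip (prod_sign (prod_sign u)) v = ip u v.
Proof. by rewrite /= /prod_ip /= !ipRl !starN !star1 !mulN1r opprK. Qed.

Lemma sn_prod_sign (u : prod_preHilbert) : sn (prod_sign u) <= 1 * sn u.
Proof. by rewrite mul1r /sn prod_sign_adj -ip_star prod_signK ip_star. Qed.

Lemma prod_sign_lact a (u v : prod_preHilbert) :
  ip (prod_sign (ph_lact a u)) v = ip (ph_lact a (prod_sign u)) v.
Proof.
by rewrite /= /prod_ip /= ipRl !ph_adj ipRl.
Qed.

End ProductSpace.

(** * The pre-Hilbert space of a completely positive kernel *)

Section KernelSpace.
Context (R : realType) (X : Type) (A B : cstarAlgType R) (k : kernel X A B).
Implicit Types (s t u : seq (X * A * B)) (a : A) (b : B).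

Lemma blinear_linear (f : blinear A B) : linear f.
Proof. by case: f => f /= /asboolP[]. Qed.

(** A triple (x, a, b) represents a iota(x) b and a list the sum of its entries, so that addition is
    concatenation. *)
Definition kterm (p q : X * A * B) : B :=
  star p.2 * k p.1.1 q.1.1 (star p.1.2 * q.1.2) * q.2.

Definition kip s t : B := \sum_(p <- s) \sum_(q <- t) kterm p q.

Definition kract s b := [seq (p.1, p.2 * b) | p <- s].
Definition klact a s := [seq (p.1.1, a * p.1.2, p.2) | p <- s].

Lemma kipDr s t u : kip s (t ++ u) = kip s t + kip s u.
Proof. by rewrite /kip -big_split; apply: eq_bigr => p _; rewrite big_cat. Qed.

Lemma kipDl s t u : kip (s ++ t) u = kip s u + kip t u.
Proof. by rewrite /kip big_cat. Qed.

Lemma kipRr s t b : kip s (kract t b) = kip s t * b.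
Proof.
rewrite /kip mulr_suml; apply: eq_bigr => p _.
by rewrite big_map mulr_suml; apply: eq_bigr => q _; rewrite /kterm /= mulrA.
Qed.

Lemma kipRl s t b : kip (kract s b) t = star b * kip s t.
Proof.
rewrite /kip mulr_sumr big_map; apply: eq_bigr => p _.
rewrite mulr_sumr; apply: eq_bigr => q _.
by rewrite /kterm /= starMr !mulrA.
Qed.

Lemma kip_adj a s t : kip (klact a s) t = kip s (klact (star a) t).
Proof.
rewrite /kip big_map; apply: eq_bigr => p _.
by rewrite big_map; apply: eq_bigr => q _; rewrite /kterm /= starMr mulrA.
Qed.

Lemma kip_lactD a a' s t :
  kip s (klact (a + a') t) = kip s (klact a t) + kip s (klact a' t).
Proof.
rewrite /kip -big_split; apply: eq_bigr => p _ /=.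
rewrite !big_map -big_split; apply: eq_bigr => q _ /=.
by rewrite /kterm /= mulrDl mulrDr (linD (blinear_linear _)) mulrDr mulrDl.
Qed.

Lemma kip_lactZ (l : R[i]) a s t :
  kip s (klact (l *: a) t) = l *: kip s (klact a t).
Proof.
rewrite /kip scaler_sumr; apply: eq_bigr => p _.
rewrite !big_map scaler_sumr; apply: eq_bigr => q _ /=.
rewrite /kterm /= cscalerAl cscalerAr (linZ (blinear_linear _)).
by rewrite cscalerAr cscalerAl.
Qed.

Lemma kip_lactM a a' s t :
  kip s (klact (a * a') t) = kip s (klact a (klact a' t)).
Proof.
rewrite /kip; apply: eq_bigr => p _; rewrite !big_map.
by apply: eq_bigr => q _; rewrite /kterm /= !mulrA.
Qed.

Lemma kip_lact1 s t : kip s (klact 1 t) = kip s t.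
Proof.
rewrite /kip; apply: eq_bigr => p _; rewrite !big_map.
by apply: eq_bigr => q _; rewrite /kterm /= mul1r.
Qed.

Hypothesis k_cp : completely_positive k.

Lemma kip_nneg s : nneg (kip s s).
Proof.
have -> : kip s s = \sum_(i < size s) \sum_(j < size s)
    kterm (tnth (in_tuple s) i) (tnth (in_tuple s) j).
  by rewrite /kip big_tnth; apply: eq_bigr => i _; rewrite big_tnth.
by apply/cstar_posP; apply: k_cp (fun i => (tnth (in_tuple s) i).1.1)
  (fun i => (tnth (in_tuple s) i).1.2) (fun i => (tnth (in_tuple s) i).2).
Qed.

(* Polarization: only the quadratic form [kip s s] is known to be
   self-adjoint. *)
Lemma kip_star s t : star (kip s t) = kip t s.
Proof.
have sa u : star (kip u u) = kip u u by apply/nneg_sa/kip_nneg.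
have E u : star (kip s u) + star (kip u s) = kip s u + kip u s.
  have := sa (s ++ u); rewrite !(kipDr, kipDl) !starD !sa -!addrA => /addrI.
  by rewrite !addrA => /addIr; rewrite addrC [RHS]addrC.
have H1 := E t; have := E (kract t ('i *: (1 : B))).
rewrite kipRr kipRl starZi star1 cscalerAr mulr1 mulNr cscalerAl mul1r.
rewrite starN !starZi opprK -!scalerN -!scalerDr.
move=> /(congr1 (fun z => - 'i *: z)); rewrite !scalerA !mulNr mulCii opprK.
rewrite !scale1r; move: (star (kip s t)) (star (kip t s)) H1 => P Q H1 H2.
suff : P + P = kip t s + kip t s.
  rewrite -!scale2C => /(congr1 (fun z => (2^-1 : R)%:C *: z)).
  by rewrite !scalerA -rmorphM/= mulVf ?pnatr_eq0// !scale1r => ->.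
have -> : P + P = (P + Q) - (- P + Q).
  by rewrite opprD opprK addrACA subrr addr0.
by rewrite H1 H2 opprB [kip s t + _]addrC addrACA subrr addr0.
Qed.

Definition kernel_semi := SemiInner [::] kipDr kipRr kip_star kip_nneg.

Definition kernel_preHilbert :=
  @PreHilbert R A B kernel_semi klact kip_adj kip_lactD kip_lactZ
  kip_lactM kip_lact1.

Definition kvec x : kernel_preHilbert := [:: (x, 1, 1)].

Lemma kip_kvec x y a : kip (kvec x) (klact a (kvec y)) = k x y a.
Proof. by rewrite /kip !big_seq1 /kterm /= !star1 !mul1r !mulr1. Qed.

End KernelSpace.

(** * Self-adjoint contractions on correspondences and their kernels *)

Section CorrespondenceSpace.
Context (R : realType) (A B : cstarAlgType R) (E : correspondenceType A B).
Implicit Types (a : A) (b : B) (e f g : E).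

Fact inner_nneg e : nneg (inner e e : B).
Proof. exact/cstar_posP/inner_pos. Qed.

(** Viewing a correspondence as a pre-Hilbert space gives it the Cauchy-Schwarz inequality and the
    bound on the left action. *)
Definition hilbert_semi :=
  @SemiInner R B E 0 +%R (@ract R B E) (@inner R B E)
  (@innerDr R B E) (@inner_ract R B E) (@inner_star R B E) inner_nneg.

Fact inner_lactD a a' e f :
  inner e (lact (a + a') f) = inner e (lact a f) + inner e (lact a' f) :> B.
Proof. by rewrite lactD innerDr. Qed.

Fact inner_lactZ (l : R[i]) a e f :
  inner e (lact (l *: a) f) = l *: inner e (lact a f) :> B.
Proof. by rewrite lactZ innerZr. Qed.

Fact inner_lactM a a' e f :
  inner e (lact (a * a') f) = inner e (lact a (lact a' f)) :> B.
Proof. by rewrite lactM. Qed.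

Fact inner_lact1 e f : inner e (lact 1 f) = inner e f :> B.
Proof. by rewrite lact1. Qed.

Definition hilbert_preHilbert :=
  @PreHilbert R A B hilbert_semi (@lact R A B E) (@lact_star R A B E)
  inner_lactD inner_lactZ inner_lactM inner_lact1.

Lemma sn_nrm e : sn (e : hilbert_semi) = nrm e.
Proof.
rewrite /sn /=; have -> : nrm (inner e e : B) = nrm e ^+ 2.
  by apply: complexI; rewrite rmorphXn/= -!nrmE inner_norm.
by rewrite sqrtr_sqr ger0_norm// nrm_ge0.
Qed.

Lemma nrm_inner e f : nrm (inner e f : B) <= nrm e * nrm f.
Proof. by have := @ip_cauchy R B hilbert_semi e f; rewrite !sn_nrm. Qed.

Lemma nrm_lact a e : nrm (lact a e) <= nrm a * nrm e.
Proof. by have := @sn_lact R A B hilbert_preHilbert a e; rewrite !sn_nrm. Qed.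

Lemma innerDl e f g : inner (e + f) g = inner e g + inner f g :> B.
Proof. exact: (@ipDl R B hilbert_semi). Qed.

Lemma inner_ractl e f b : inner (ract e b) f = star b * inner e f :> B.
Proof. exact: (@ipRl R B hilbert_semi). Qed.

Lemma innerZl (l : R[i]) e f : inner (l *: e) f = l^* *: inner e f :> B.
Proof. by rewrite -inner_star innerZr starZ inner_star. Qed.

Lemma innerBr e f g : inner e (f - g) = inner e f - inner e g :> B.
Proof. by rewrite innerDr -scaleN1r innerZr scaleN1r. Qed.

Lemma innerBl e f g : inner (e - f) g = inner e g - inner f g :> B.
Proof. by rewrite -inner_star innerBr starB !inner_star. Qed.

Lemma inner0r e : inner e 0 = 0 :> B.
Proof. by rewrite -(subrr 0) innerBr subrr. Qed.

Lemma inner0l e : inner 0 e = 0 :> B.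
Proof. by rewrite -inner_star inner0r star0. Qed.

Lemma inner_inj e f : (forall g, inner g e = inner g f :> B) -> e = f.
Proof.
by move=> ef; apply/subr0_eq/inner_def; rewrite innerBr ef subrr.
Qed.

Lemma inner_cvg (u : nat -> E) e f :
  u @ \oo --> e -> (fun n => inner (u n) f : B) @ \oo --> (inner e f : B).
Proof.
move=> /cvg_nrmP ue; apply: (cvg_squeeze (b := fun n => nrm (u n - e) * nrm f)).
  by move=> n; rewrite -innerBl nrm_inner.
by rewrite -(mul0r (nrm f)); apply: cvgM => //; exact: cvg_cst.
Qed.

Fact inner_lact_bounded e f :
  (fun a => inner e (lact a f) : B) \in @bounded_linear_pred R A B.
Proof.
apply/asboolP; split=> [l a b|]; first by rewrite inner_lactD inner_lactZ.
exists (nrm e * nrm f)%:C => a; rewrite !nrmE -rmorphM/= lecR.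
rewrite (le_trans (nrm_inner _ _))// -mulrA ler_wpM2l ?nrm_ge0//.
by rewrite mulrC nrm_lact.
Qed.

Section SelfAdjoint.
Variable J : E -> E.
Hypothesis J_sa : self_adjoint J.

Lemma self_adjoint_linear : linear J.
Proof.
move=> l e f; apply: inner_inj => g.
by rewrite -J_sa !innerDr !innerZr -!J_sa.
Qed.

Lemma self_adjoint_ract e b : J (ract e b) = ract (J e) b.
Proof.
by apply: inner_inj => g; rewrite -J_sa !inner_ract -J_sa.
Qed.

Hypothesis J_contr : forall e, nrm (J e) <= nrm e.

(** The iterates are real polynomials in J, hence self-adjoint, and the inner product is continuous
    in each variable. *)
Lemma sqrt1B_self_adjoint : self_adjoint (sqrt1B J).
Proof.
move=> e f; have J_lin := self_adjoint_linear.
have V n e' f' : inner (visser J n e') f' = inner e' (visser J n f') :> B.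
  elim: n e' f' => [|n IHn] e' f' /=.
    by rewrite inner0l inner0r.
  rewrite innerZl innerZr innerDl innerDr !IHn J_sa.
  by rewrite conj_Creal// complex_real.
suff : inner (e - sqrt1B J e) f = inner e (f - sqrt1B J f) :> B.
  by rewrite innerBl innerBr => /addrI/oppr_inj.
have C x := @visser_cvg R E J J_lin J_contr x.
apply: cvg_seq_unique (@inner_cvg _ _ f (C e)) _.
have := cvg_star (@inner_cvg _ _ e (C f)); rewrite inner_star.
rewrite (_ : _ \o _ = fun n => inner (visser J n e) f)//.
by apply/funext => n /=; rewrite inner_star V.
Qed.

Lemma inner_1B_nneg e : nneg (inner (e - J e) e : B).
Proof.
rewrite -(sqrt1BK self_adjoint_linear J_contr) sqrt1B_self_adjoint.
exact: inner_nneg.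
Qed.

End SelfAdjoint.

Section KernelOfMap.
Context (X : Type) (iota : X -> E).

Definition map_kernel (S : E -> E) : kernel X A B :=
  fun x y => Blinear (inner_lact_bounded (S (iota x)) (iota y)).

(** The double sum collapses to <S e, e> for e the sum of the a_i iota(x_i) b_i. *)
Lemma map_kernel_cp (S : E -> E) :
  linear S -> (forall e b, S (ract e b) = ract (S e) b) ->
  (forall a e, S (lact a e) = lact a (S e)) ->
  (forall e, nneg (inner (S e) e : B)) -> completely_positive (map_kernel S).
Proof.
move=> S_lin Sr Sl S0 n x a b; apply/cstar_posP.
pose e i := ract (lact (a i) (iota (x i))) (b i).
have -> : \sum_(i < n) \sum_(j < n) star (b i) *
    map_kernel S (x i) (x j) (star (a i) * a j) * b j =
    inner (S (\sum_(i < n) e i)) (\sum_(j < n) e j).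
  rewrite (big_morph S (linD S_lin) (lin0 S_lin)).
  rewrite (big_morph (fun f => inner f _ : B) (fun f g => innerDl f g _)
    (inner0l _)).
  apply: eq_bigr => i _.
  rewrite (big_morph (inner _) (innerDr _) (inner0r _)).
  apply: eq_bigr => j _.
  rewrite -[map_kernel S _ _ _]/(inner (S (iota (x i))) (lact _ (iota (x j)))).
  by rewrite /e Sr Sl inner_ractl inner_ract lact_star lactM mulrA.
exact: S0.
Qed.

End KernelOfMap.
End CorrespondenceSpace.

(** * From decompositions to differences and back *)

Section Kernels.
Context (R : realType) (X : Type) (A B : cstarAlgType R).
Implicit Types k : kernel X A B.

Lemma kernelP k1 k2 : (forall x y a, k1 x y a = k2 x y a) -> k1 = k2.
Proof.
move=> kE; apply/funext => x; apply/funext => y; apply/val_inj/funext => a.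
exact: kE.
Qed.

Lemma completely_positiveD k1 k2 : completely_positive k1 ->
  completely_positive k2 -> completely_positive (k1 + k2).
Proof.
move=> k1p k2p n x a b; apply/cstar_posP.
have := nnegD ((cstar_posP _).1 (k1p n x a b)) ((cstar_posP _).1 (k2p n x a b)).
congr nneg; rewrite -big_split; apply: eq_bigr => i _.
rewrite -big_split; apply: eq_bigr => j _ /=.
by rewrite -mulrDl -mulrDr.
Qed.

Lemma hermitian_cp_difference k (E : correspondenceType A B) (iota : X -> E)
  (J : E -> E) : hermitian_decomposition k iota J -> cp_difference k.
Proof.
move=> [[_ J_contr Jl kE] J_sa].
have Jc e : nrm (J e) <= nrm e by rewrite -lecR -!nrmE J_contr.
have J_lin := self_adjoint_linear J_sa.
exists (map_kernel iota id), (map_kernel iota (fun e => e - J e)); split.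
- by apply: map_kernel_cp => // e; exact: inner_nneg.
- apply: map_kernel_cp.
  + by move=> l e f; rewrite J_lin scalerBr opprD addrACA.
  + move=> e b; rewrite (self_adjoint_ract J_sa).
    by rewrite ractDl -scaleN1r -ractZl scaleN1r.
  (* Additivity of the left action in the vector is drawn from its adjoint. *)
  + move=> a e; rewrite Jl; apply: inner_inj => g.
    have aE f : inner g (lact a f) = inner (lact (star a) g) f :> B.
      by rewrite lact_star starK.
    by rewrite innerBr !aE innerBr.
  + by move=> e; exact: inner_1B_nneg.
- apply: kernelP => x y a; rewrite kE.
  by rewrite -[RHS]/(inner _ _ - inner _ _) -innerBl subKr.
Qed.

(** Inside inner products the sign is symmetric with square 1, so it preserves [sn], and J is
    contractive. *)
Lemma difference_involutive_decomposition k1 k2 :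
  completely_positive k1 -> completely_positive k2 ->
  exists (E : correspondenceType A B) (iota : X -> E) (J : E -> E),
    hermitian_decomposition (k1 - k2) iota J /\ (forall e, J (J e) = e).
Proof.
move=> k1p k2p.
pose V := prod_preHilbert (kernel_preHilbert k1p) (kernel_preHilbert k2p).
pose T := @prod_sign _ _ _ (kernel_preHilbert k1p) (kernel_preHilbert k2p).
pose J : hcompl V -> hcompl V :=
  ext (@prod_sign_adj _ _ _ _ _) (@sn_prod_sign _ _ _ _ _).
pose vec x : V := (kvec k1p x, kvec k2p x).
have J_sa : self_adjoint J by move=> f g; apply: inner_ext.
have Jc f : hnorm (J f) <= hnorm f.
  by rewrite -[leRHS]mul1r; apply: hnorm_ext.
exists (hcompl V), (fun x => embed (vec x)), J; split; [split=> //; split|].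
- by exists J.
- by move=> f; rewrite !nrmE lecR; exact: Jc.
- move=> a f; apply: hcompl_eq => w /=.
  by apply: hfun_eq => v; rewrite prod_sign_lact.
- move=> x y a; rewrite /J ext_embed inner_embed.
  rewrite -[RHS]/(ip (ph_lact (star a) (T (vec x))) (vec y)) ph_adj starK.
  rewrite -[RHS]/(kip k1 (kvec k1p x) (klact a (kvec k1p y)) +
    kip k2 (kract (kvec k2p x) (-1)) (klact a (kvec k2p y))).
  by rewrite kipRl starN star1 mulN1r !kip_kvec.
- move=> f; apply: hcompl_eq => w /=; apply: hfun_eq => v.
  exact: prod_signK.
Qed.

End Kernels.

Theorem theorem3p1 (R : realType) (X : Type) (A B : cstarAlgType R)
    (k : kernel X A B) :
  [<-> cp_difference k;
       exists L : kernel X A B,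
         [/\ completely_positive L, kernel_le (- L) k & kernel_le k L];
       exists L : kernel X A B, completely_positive L /\ kernel_le k L;
       exists (E : correspondenceType A B) (iota : X -> E) (J : E -> E),
         hermitian_decomposition k iota J;
       exists (E : correspondenceType A B) (iota : X -> E) (J : E -> E),
         hermitian_decomposition k iota J /\ (forall e, J (J e) = e)].
Proof.
tfae.
(* With L = k1 + k2, k + L = 2 k1 and L - k = 2 k2. *)
- move=> [k1 [k2 [k1p k2p ->]]]; exists (k1 + k2); split.
  + exact: completely_positiveD.
  + rewrite /kernel_le opprK addrACA addNr addr0.
    exact: completely_positiveD.
  + rewrite /kernel_le opprB addrC subrKA.
    exact: completely_positiveD.
- by move=> [L [Lp _ kL]]; exists L.
(* k = L - (L - k) is a difference of completely positive kernels. *)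
- move=> [L [Lp kL]].
  have [E [iota [J [kJ _]]]] := difference_involutive_decomposition Lp kL.
  by exists E, iota, J; rewrite subKr in kJ.
- move=> [E [iota [J /hermitian_cp_difference[k1 [k2 [k1p k2p ->]]]]]].
  exact: difference_involutive_decomposition.
- by move=> [E [iota [J [/hermitian_cp_difference]]]].
Qed.
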